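(* Let $A,B,C,A_1,B_1\in\mathbb{C}^{N\times N}$ be pairwise commuting positive stable matrices such that $B_1-A_1$ is positive stable and invertible. Then for $|z|<1$, $$\int_0^1 t^{A_1-I}(1-t)^{B_1-A_1-I}\,{}_1F_2(A;B,C;zt)\,dt=\Gamma(A_1)\Gamma(B_1-A_1)\Gamma^{-1}(B_1)\,{}_2F_3(A,A_1;B,B_1,C;z)$$ and $$\int_0^1 t^{A_1-I}(1-t)^{B_1-I}\,{}_1F_2(A;B,C;zt)\,dt=\Gamma(A_1)\Gamma(B_1)\Gamma^{-1}(A_1+B_1)\,{}_2F_3(A,A_1;B,A_1+B_1,C;z).$$
   Context: $I$ is the $N\times N$ identity matrix. A matrix is positive stable if all its eigenvalues have positive real part. For $M\in\mathbb{C}^{N\times N}$, $(M)_0=I$, $(M)_k=M(M+I)\cdots(M+(k-1)I)$ for $k\ge1$; for $t>0$, $t^M=\exp(M\ln t)$. For $M$ positive stable $\Gamma(M)=\int_0^\infty e^{-t}t^{M-I}\,dt$, with inverse $\Gamma^{-1}(M)$. For commuting matrices, ${}_1F_2(A;B,C;z)=\sum_{k\ge0}\frac{z^k}{k!}(A)_k[(B)_k]^{-1}[(C)_k]^{-1}$ and ${}_2F_3(A,A';B,B',C;z)=\sum_{k\ge0}\frac{z^k}{k!}(A)_k(A')_k[(B)_k]^{-1}[(B')_k]^{-1}[(C)_k]^{-1}$. *)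

(* Defs.v *)
From HB Require Import structures.
From mathcomp Require Import all_boot all_order all_algebra.
From mathcomp.real_closed Require Import complex.
From mathcomp Require Import all_classical all_reals all_analysis.

Set Implicit Arguments.
Unset Strict Implicit.
Unset Printing Implicit Defensive.

Import Order.TTheory GRing.Theory Num.Theory.
Import numFieldNormedType.Exports.

Local Open Scope classical_set_scope.
Local Open Scope complex_scope.
Local Open Scope ring_scope.

(* the topology of R[i] given by the modulus *)
HB.instance Definition _ (R : realType) := GRing.ComAlgebra.copy R[i] R[i]^o.
HB.instance Definition _ (R : realType) := Vector.copy R[i] R[i]^o.
HB.instance Definition _ (R : realType) := NormedModule.copy R[i] R[i]^o.

Section MatrixFunctions.
Context {R : realType} {N : nat}.
Implicit Types (A B C M : 'M[R[i]]_N) (D : set R) (F : R -> 'M[R[i]]_N).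

Definition positive_stable M : Prop :=
  forall a : R[i], eigenvalue M a -> 0 < complex.Re a.

Definition mx_pochhammer M (k : nat) : 'M[R[i]]_N :=
  \prod_(j < k) (M + (j%:R)%:M).

Definition mx_exp_term M (k : nat) : 'M[R[i]]_N := (k`!%:R)^-1 *: M ^+ k.

Definition mx_exp M : 'M[R[i]]_N := limn (series (mx_exp_term M)).

(* t ^ M, meaningful for 0 < t only *)
Definition mx_rpow (t : R) M : 'M[R[i]]_N := mx_exp ((ln t)%:C *: M).

(* Lebesgue integrals of matrix-valued functions of a real variable are taken
   entry by entry, on real and imaginary parts.  [mx_integral D F] is a total
   operation, meaningful only under [mx_integrable D F]. *)
Definition mx_integrable D F : Prop := forall i j,
  lebesgue_measure.-integrable D (EFin \o (fun t => complex.Re (F t i j))) /\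
  lebesgue_measure.-integrable D (EFin \o (fun t => complex.Im (F t i j))).

Definition mx_integral D F : 'M[R[i]]_N := \matrix_(i, j)
  ((\int[lebesgue_measure]_(t in D) complex.Re (F t i j)) +i*
   (\int[lebesgue_measure]_(t in D) complex.Im (F t i j))).

Definition mx_Gamma_integrand M (t : R) : 'M[R[i]]_N :=
  (expR (- t))%:C *: mx_rpow t (M - 1%:M).

Definition mx_Gamma M : 'M[R[i]]_N :=
  mx_integral `]0, +oo[ (mx_Gamma_integrand M).

Definition hyp1F2_term A B C (z : R[i]) (k : nat) : 'M[R[i]]_N :=
  (z ^+ k / k`!%:R) *:
  (mx_pochhammer A k *m invmx (mx_pochhammer B k) *m invmx (mx_pochhammer C k)).

Definition hyp1F2 A B C (z : R[i]) : 'M[R[i]]_N :=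
  limn (series (hyp1F2_term A B C z)).

Definition hyp2F3_term A A' B B' C (z : R[i]) (k : nat) : 'M[R[i]]_N :=
  (z ^+ k / k`!%:R) *:
  (mx_pochhammer A k *m mx_pochhammer A' k *m invmx (mx_pochhammer B k)
     *m invmx (mx_pochhammer B' k) *m invmx (mx_pochhammer C k)).

Definition hyp2F3 A A' B B' C (z : R[i]) : 'M[R[i]]_N :=
  limn (series (hyp2F3_term A A' B B' C z)).

End MatrixFunctions.

(* Main.v *)
From HB Require Import structures.
Require Import Defs.
From mathcomp Require Import all_boot all_order all_algebra.
From mathcomp.real_closed Require Import complex.
From mathcomp Require Import all_classical all_reals all_analysis.
From mathcomp Require Import measurable_realfun.
From mathcomp Require Import ring lra.

Import Order.TTheory GRing.Theory Num.Theory.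
Import numFieldNormedType.Exports.

Local Open Scope classical_set_scope.
Local Open Scope complex_scope.
Local Open Scope ring_scope.


(** Both identities are instances of one statement, with (A1, D) equal to
    (A1, B1 - A1) and to (A1, B1).  Against the Beta kernel t^(A1-1) (1-t)^(D-1)
    the power t^k integrates to B(A1+k, D) = (A1)_k (A1+D)_k^(-1) B(A1, D), so
    integrating the series of 1F2 term by term inserts exactly the factors that
    turn it into 2F3, and leaves B(A1, D) = Gamma(A1) Gamma(D) Gamma(A1+D)^(-1)
    in front ([beta_series], [hyp1F2_beta_integral]).

    The analysis takes place over the reals.  A complex matrix X + iY is replaced
    by the real matrix of twice its size with blocks X, Y, -Y, X ([realify]); this
    is an injective morphism of real algebras which commutes with limits,
    inverses and integrals.

    Positive stability is used only through the decay of t^A at 0: the norm of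
    t^A is at most K t^c for some c > 0 ([mx_stable]).  Given the eigenvalues,
    this is obtained as follows.  For small h > 0 the eigenvalues of P = 1 - hA
    lie in a disc of radius less than 1.  The characteristic polynomial, a
    product of linear factors, annihilates P up to rescaling; removing the
    factors one at a time shows that the powers of P decay geometrically
    ([annihilated_power_bounded]).  Finally t^A = t^(1/h) exp(yP) with
    y = - ln t / h, and the exponential series gives the bound
    ([power_bounded_stable], [positive_stable_realify]).

    The relation between Beta and Gamma comes from one-variable arguments.
    Integration by parts gives (A+D) B(A, D+1) = D B(A, D), hence
    B(A, D+1+k) = (D+1)_k (A+D+1)_k^(-1) B(A, D+1).  The substitution t = s/k and
    dominated convergence give k^A B(A, D+1+k) -> Gamma(A) ([gauss_limit]); for
    D = 0 this is Euler's limit k! k^M (M+1)_k^(-1) -> Gamma(M) M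
    ([euler_limit]).  Multiplying Gauss's limit for A by Euler's for D, and
    comparing with Euler's for A + D, yields
    Gamma(A+D) B(A, D) = Gamma(A) Gamma(D) ([mbeta_mgamma]).  Gamma(M) is
    invertible because the inverses of Euler's products stay bounded: their
    consecutive ratios (1 + xM)(1-x)^M, x = 1/k, are 1 + O(x^2)
    ([mgamma_unit]). *)

(** * Norm, limits and series of real matrices *)

Section RealMatrices.
Context {R : realType} {n : nat}.
Implicit Types (A B L M : 'M[R]_n) (u v : nat -> 'M[R]_n).

Definition entry_norm A : R := \sum_i \sum_j `|A i j|.
Local Notation nm := entry_norm.

Lemma entry_norm_ge0 A : 0 <= nm A.
Proof. by apply: sumr_ge0 => i _; apply: sumr_ge0 => j _. Qed.
Local Notation nm_ge0 := entry_norm_ge0.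

Lemma entry_norm_entry A i j : `|A i j| <= nm A.
Proof.
rewrite /entry_norm (bigD1 i)//= (bigD1 j)//= -addrA lerDl addr_ge0//.
  by apply: sumr_ge0.
by apply: sumr_ge0 => k _; apply: sumr_ge0.
Qed.

Lemma entry_norm0 : nm 0 = 0.
Proof. by rewrite /nm big1// => i _; rewrite big1// => j _; rewrite mxE normr0. Qed.

Lemma entry_norm_eq0 A : nm A <= 0 -> A = 0.
Proof.
move=> A0; apply/matrixP => i j; rewrite mxE; apply/eqP.
by rewrite -normr_le0 (le_trans (entry_norm_entry A i j)).
Qed.

Lemma entry_normD A B : nm (A + B) <= nm A + nm B.
Proof.
rewrite /nm -big_split/=; apply: ler_sum => i _.
rewrite -big_split/=; apply: ler_sum => j _.
by rewrite mxE ler_normD.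
Qed.

Lemma entry_normZ (c : R) A : nm (c *: A) = `|c| * nm A.
Proof.
rewrite /nm mulr_sumr; apply: eq_bigr => i _.
by rewrite mulr_sumr; apply: eq_bigr => j _; rewrite mxE normrM.
Qed.

Lemma entry_normN A : nm (- A) = nm A.
Proof. by rewrite -scaleN1r entry_normZ normrN1 mul1r. Qed.

Lemma entry_normB A B : nm (A - B) <= nm A + nm B.
Proof. by rewrite -(entry_normN B) entry_normD. Qed.

Lemma entry_norm_sum I (r : seq I) (P : pred I) (F : I -> 'M[R]_n) :
  nm (\sum_(i <- r | P i) F i) <= \sum_(i <- r | P i) nm (F i).
Proof.
elim/big_rec2: _ => [|i y x _ le]; first by rewrite entry_norm0.
by rewrite (le_trans (entry_normD _ _))// lerD2l.
Qed.

Lemma entry_normM A B : nm (A *m B) <= nm A * nm B.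
Proof.
rewrite {2}/nm mulr_suml; apply: ler_sum => i _.
apply: (@le_trans _ _ (\sum_j \sum_k `|A i k| * `|B k j|)).
  apply: ler_sum => j _; rewrite mxE (le_trans (ler_norm_sum _ _ _))//.
  by apply: ler_sum => k _; rewrite normrM.
rewrite exchange_big/= mulr_suml; apply: ler_sum => k _.
rewrite -mulr_sumr ler_wpM2l// [leRHS](bigD1 k)//= lerDl.
by apply: sumr_ge0 => l _; apply: sumr_ge0.
Qed.

Lemma entry_norm_le A (c : R) : (forall i j, `|A i j| <= c) -> nm A <= n%:R ^+ 2 * c.
Proof.
move=> Ac; apply: (@le_trans _ _ (\sum_(i < n) \sum_(j < n) c)).
  by apply: ler_sum => i _; apply: ler_sum => j _.
by rewrite !sumr_const card_ord expr2 -mulrA !mulr_natl.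
Qed.

Lemma entry_norm1 : nm 1%:M = n%:R.
Proof.
rewrite /nm (eq_bigr (fun=> 1)) ?sumr_const ?card_ord// => i _.
rewrite (bigD1 i)//= big1 ?addr0 ?mxE ?eqxx ?normr1// => j ji.
by rewrite mxE eq_sym (negPf ji) normr0.
Qed.

(** The factor 1 + n accounts for k = 0, the identity having norm n. *)
Lemma entry_normX A k : nm (A ^+ k) <= (1 + n%:R) * nm A ^+ k.
Proof.
elim: k => [|k IH]; first by rewrite !expr0 mulr1 entry_norm1 lerDr.
rewrite exprSr -mulmxE (le_trans (entry_normM _ _))// exprSr mulrA.
by rewrite ler_wpM2r ?nm_ge0.
Qed.

(** Limits, derivatives and integrals of matrices are taken entry by entry, so
    that each is read off from its scalar version; the norm only supplies bounds. *)
Definition mx_cvg u L := forall i j, u k i j @[k --> \oo] --> L i j.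
Local Notation "u ~> L" := (mx_cvg u L) (at level 70).

Lemma mx_cvg_unique {u L L'} : u ~> L -> u ~> L' -> L = L'.
Proof. by move=> uL uL'; apply/matrixP => i j; exact: cvg_unique (uL i j) (uL' i j). Qed.

Lemma mx_cvg_cst A : (fun=> A) ~> A.
Proof. by move=> i j; exact: cvg_cst. Qed.

Lemma mx_cvg_eq {u} v {L} : u =1 v -> v ~> L -> u ~> L.
Proof. by move=> /funext ->. Qed.

Lemma cvg_bigsum (I : Type) (r : seq I) (f : I -> nat -> R) (l : I -> R) :
  (forall i, f i k @[k --> \oo] --> l i) ->
  \sum_(i <- r) f i k @[k --> \oo] --> \sum_(i <- r) l i.
Proof.
move=> fl; elim: r => [|i r IH].
  by rewrite big_nil; under eq_fun do rewrite big_nil; exact: cvg_cst.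
by rewrite big_cons; under eq_fun do rewrite big_cons; apply: cvgD.
Qed.

Lemma mx_cvgM {u v L L'} : u ~> L -> v ~> L' -> (fun k => u k *m v k) ~> (L *m L').
Proof.
move=> uL vL i j; rewrite mxE; under eq_fun do rewrite mxE.
by apply: cvg_bigsum => l; apply: cvgM; [exact: uL|exact: vL].
Qed.

Lemma mx_cvgZ {c : nat -> R} {l : R} {u L} : c k @[k --> \oo] --> l -> u ~> L ->
  (fun k => c k *: u k) ~> (l *: L).
Proof.
move=> cl uL i j; rewrite mxE; under eq_fun do rewrite mxE.
by apply: cvgM => //; exact: uL.
Qed.

Lemma mx_cvg_norm {u L} : u ~> L -> nm (u k) @[k --> \oo] --> nm L.
Proof.
move=> uL; apply: cvg_bigsum => i; apply: cvg_bigsum => j.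
by apply: cvg_norm; exact: uL.
Qed.

Lemma mx_cvg_norm_le {u L} {c : R} : u ~> L -> (forall k, nm (u k) <= c) -> nm L <= c.
Proof.
move=> /mx_cvg_norm uL uc; rewrite -(cvg_lim (@Rhausdorff R) uL).
by apply: limr_le; [apply: cvgP uL|exact: nearW].
Qed.

Lemma mx_cvg_comm {u L M} : u ~> L -> (forall k, comm_mx M (u k)) -> comm_mx M L.
Proof.
move=> uL uM; rewrite /comm_mx.
have uML := mx_cvgM (mx_cvg_cst M) uL.
have uLM := mx_cvgM uL (mx_cvg_cst M).
by apply: (mx_cvg_unique uML); exact: (mx_cvg_eq _ uM uLM).
Qed.

Definition mx_summable u := cvgn (series (fun k => nm (u k))).

Definition mx_sum u : 'M[R]_n :=
  \matrix_(i, j) limn (series (fun k => u k i j)).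

Lemma mx_summable_entry {u} i j : mx_summable u -> cvgn (series (fun k => u k i j)).
Proof.
move=> us; apply: normed_cvg; apply: (series_le_cvg _ _ _ us) => k /=.
- exact: normr_ge0.
- exact: nm_ge0.
- exact: entry_norm_entry.
Qed.

Lemma mx_sum_cvg {u} : mx_summable u -> (fun m => \sum_(k < m) u k) ~> mx_sum u.
Proof.
move=> us i j; rewrite mxE; under eq_fun do rewrite summxE.
have := mx_summable_entry i j us.
by rewrite /series/=; under eq_fun do rewrite big_mkord.
Qed.

Lemma mx_summable_le {u} {c : nat -> R} : cvgn (series c) -> (forall k, nm (u k) <= c k) ->
  mx_summable u.
Proof.
move=> cc uc; apply: (series_le_cvg _ _ _ cc) => k /=; [exact: nm_ge0| |exact: uc].
by rewrite (le_trans _ (uc k))// nm_ge0.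
Qed.

Lemma mx_sum_partial_le {u} {c : nat -> R} m : cvgn (series c) -> (forall k, nm (u k) <= c k) ->
  nm (\sum_(k < m) u k) <= limn (series c).
Proof.
move=> cc uc; apply: (le_trans (entry_norm_sum _ _ _ _)).
rewrite (@le_trans _ _ (series c m))//.
  by rewrite /series/= big_mkord; apply: ler_sum.
apply: nondecreasing_cvgn_le => //; apply: nondecreasing_series => k _ _.
by rewrite (le_trans _ (uc k))// nm_ge0.
Qed.

Lemma mx_sum_norm_le {u} {c : nat -> R} : cvgn (series c) -> (forall k, nm (u k) <= c k) ->
  nm (mx_sum u) <= limn (series c).
Proof.
move=> cc uc; apply: (mx_cvg_norm_le (mx_sum_cvg (mx_summable_le cc uc))) => m.
exact: mx_sum_partial_le.
Qed.

End RealMatrices.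

Local Notation "u ~> L" := (mx_cvg u L) (at level 70).
Local Notation nm := entry_norm.
Local Notation nm_ge0 := entry_norm_ge0.

(** * Derivatives of matrix-valued functions *)

Section MatrixDerivative.
Context {R : realType} {n : nat}.
Implicit Types (A B M : 'M[R]_n) (F G : R -> 'M[R]_n).

Definition mx_derive F (t : R) M :=
  forall i j, is_derive t (1 : R) (fun s => F s i j) (M i j).

Lemma mx_derive_eq {F t M M'} : M = M' -> mx_derive F t M -> mx_derive F t M'.
Proof. by move=> ->. Qed.

Lemma mx_derive_cst A t : mx_derive (fun=> A) t 0.
Proof. by move=> i j; rewrite mxE; exact: is_derive_cst. Qed.

Lemma mx_deriveM {F G t} {F' G' : 'M[R]_n} : mx_derive F t F' -> mx_derive G t G' ->
  mx_derive (fun s => F s *m G s) t (F' *m G t + F t *m G').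
Proof.
move=> dF dG i j.
have -> : (fun s => (F s *m G s) i j) =
    \sum_(k < n) ((fun s => F s i k) * (fun s => G s k j)).
  by apply/funext => s; rewrite mxE fct_sumE.
rewrite !mxE -big_split/=.
apply: is_derive_sum => k; apply: is_derive_eq.
  by apply: is_deriveM; [exact: dF|exact: dG].
by rewrite /GRing.scale/= addrC (mulrC (G t k j)).
Qed.

Lemma mx_deriveZ {c : R -> R} {F t} {c' : R} {F' : 'M[R]_n} :
  is_derive t (1 : R) c c' -> mx_derive F t F' ->
  mx_derive (fun s => c s *: F s) t (c' *: F t + c t *: F').
Proof.
move=> dc dF i j.
have -> : (fun s => (c s *: F s) i j) = c * (fun s => F s i j).
  by apply/funext => s; rewrite mxE.
apply: is_derive_eq; first by apply: is_deriveM; exact: dF.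
by rewrite !mxE /GRing.scale/= addrC (mulrC _ c').
Qed.

Lemma mx_deriveD {F G t} {F' G' : 'M[R]_n} : mx_derive F t F' -> mx_derive G t G' ->
  mx_derive (fun s => F s + G s) t (F' + G').
Proof.
move=> dF dG i j.
have -> : (fun s => (F s + G s) i j) = (fun s => F s i j) + (fun s => G s i j).
  by apply/funext => s; rewrite mxE.
by rewrite mxE; apply: is_deriveD; [exact: dF|exact: dG].
Qed.

Lemma mx_derive_comp {F} {g : R -> R} {t M} {g' : R} :
  mx_derive F (g t) M -> is_derive t (1 : R) g g' ->
  mx_derive (F \o g) t (g' *: M).
Proof.
move=> dF dg i j; rewrite mxE mulrC.
exact: (@is_derive1_comp _ (fun s => F s i j)).
Qed.

Lemma mx_derive0_cst {F} s t : (forall x, mx_derive F x 0) -> F s = F t.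
Proof.
move=> dF; apply/matrixP => i j.
apply: (@is_derive_0_is_cst _ (fun x => F x i j)) => x.
by have := dF x i j; rewrite mxE.
Qed.

Lemma mx_derive_continuous {F t M} i j : mx_derive F t M ->
  {for t, continuous (fun s => F s i j)}.
Proof.
move=> /(_ i j) [dF _].
exact/differentiable_continuous/derivable1_diffP.
Qed.

End MatrixDerivative.

(** * The matrix exponential *)

Section MatrixExponential.
Context {R : realType} {n : nat}.
Implicit Types (A B M P : 'M[R]_n).

Definition mexp A : 'M[R]_n := mx_sum (fun k => (k`!%:R)^-1 *: A ^+ k).

Lemma mx_exprZ (y : R) P k : (y *: P) ^+ k = y ^+ k *: P ^+ k.
Proof.
elim: k => [|k IH]; first by rewrite !expr0 scale1r.
by rewrite !exprS IH -!mulmxE -scalemxAl -scalemxAr scalerA.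
Qed.

Lemma series_expR_scaled (c y : R) :
  series (fun k => c * (y ^+ k / k`!%:R)) k @[k --> \oo] --> c * expR y.
Proof.
rewrite (_ : series _ = (fun k => c * series (exp_coeff y) k)).
  by apply: cvgM; [exact: cvg_cst|exact: is_cvg_series_exp_coeff].
by apply/funext => k; rewrite /series/= mulr_sumr.
Qed.

(** [r] may be any growth rate of the powers of [P]: one smaller than the norm
    of [P] is what makes t^A decay at 0. *)
Lemma exp_term_norm_le {P} {c r y : R} {k} : 0 <= y -> nm (P ^+ k) <= c * r ^+ k ->
  nm ((k`!%:R)^-1 *: (y *: P) ^+ k) <= c * ((y * r) ^+ k / k`!%:R).
Proof.
move=> y0 Pk; rewrite mx_exprZ !entry_normZ.
rewrite ger0_norm ?invr_ge0// ger0_norm ?exprn_ge0//.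
rewrite exprMn mulrC -mulrA -mulrA [leRHS]mulrCA ler_wpM2l ?exprn_ge0//.
by rewrite mulrA ler_wpM2r ?invr_ge0.
Qed.

Lemma exp_summable A : mx_summable (fun k => (k`!%:R)^-1 *: A ^+ k).
Proof.
apply: (@mx_summable_le _ _ _ (fun k => (1 + n%:R) * ((1 * nm A) ^+ k / k`!%:R))).
  by apply/cvg_ex; eexists; exact: series_expR_scaled.
move=> k; rewrite -{1}[A]scale1r; apply: exp_term_norm_le => //.
exact: entry_normX.
Qed.

Lemma mexp_norm_power_le {P} {c r y : R} : 0 <= y -> (forall k, nm (P ^+ k) <= c * r ^+ k) ->
  nm (mexp (y *: P)) <= c * expR (y * r).
Proof.
move=> y0 Pk; rewrite -(cvg_lim (@Rhausdorff R) (series_expR_scaled c (y * r))).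
apply: mx_sum_norm_le => [|k]; last exact: exp_term_norm_le.
by apply/cvg_ex; eexists; exact: series_expR_scaled.
Qed.

Lemma mexp_norm_le A : nm (mexp A) <= (1 + n%:R) * expR (nm A).
Proof.
have := @mexp_norm_power_le A (1 + n%:R) (nm A) 1 ler01 (entry_normX A).
by rewrite scale1r mul1r.
Qed.

Lemma comm_mxX {A B} k : comm_mx A B -> comm_mx A (B ^+ k).
Proof.
move=> AB; elim: k => [|k IH]; first by rewrite expr0; exact: comm_mx1.
by rewrite exprS -mulmxE; exact: comm_mxM.
Qed.

Lemma comm_mexp {A B} : comm_mx A B -> comm_mx A (mexp B).
Proof.
move=> AB; apply: (mx_cvg_comm (mx_sum_cvg (exp_summable B))) => m.
apply: comm_mx_sum => k _; rewrite /comm_mx -scalemxAr -scalemxAl.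
by rewrite (comm_mxX k AB).
Qed.

Lemma mexp_scalar (x : R) : mexp x%:M = (expR x)%:M.
Proof.
apply: (mx_cvg_unique (mx_sum_cvg (exp_summable _))) => i j.
have pw k : (x%:M : 'M[R]_n) ^+ k = (x ^+ k)%:M.
  elim: k => [|k IH]; first by rewrite !expr0.
  by rewrite exprS IH -mulmxE -scalar_mxM -exprS.
rewrite mxE -mulr_natl; have := series_expR_scaled ((i == j)%:R) x.
rewrite (_ : series _ = fun m => (\sum_(k < m) (k`!%:R)^-1 *: x%:M ^+ k) i j)//.
apply/funext => m; rewrite /series/= big_mkord summxE; apply: eq_bigr => k _.
by rewrite pw !mxE mulrnAr mulr_natl mulrC.
Qed.

Lemma mexp0 : mexp 0 = 1%:M.
Proof. by have := mexp_scalar 0; rewrite expR0 -[X in mexp X]scalemx1 scale0r. Qed.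

(* The entries of x |-> B exp(xA) are power series in x; the factor B makes this
   family closed under differentiation. *)
Let coeff B A i j k : R := (B *m A ^+ k) i j / k`!%:R.

Let coeff_cvg B A i j (x : R) : cvgn (pseries (coeff B A i j) x).
Proof.
rewrite /pseries.
pose c := nm B * (1 + n%:R).
apply: normed_cvg.
apply: (@series_le_cvg _ _ (fun k => c * ((`|x| * nm A) ^+ k / k`!%:R))) => [k|k|k|] /=.
- exact: normr_ge0.
- rewrite mulr_ge0//; last by rewrite divr_ge0// exprn_ge0// mulr_ge0// nm_ge0.
  by rewrite mulr_ge0 ?nm_ge0// addr_ge0.
- rewrite /coeff /= !normrM normrX normfV normr_nat exprMn.
  rewrite [leLHS](_ : _ = `|(B *m A ^+ k) i j| * (`|x| ^+ k / k`!%:R)); last by rewrite mulrAC mulrA.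
  rewrite [leRHS](_ : _ = c * nm A ^+ k * (`|x| ^+ k / k`!%:R)); last by ring.
  rewrite ler_wpM2r ?divr_ge0 ?exprn_ge0 ?ler0n//.
  apply: (le_trans (entry_norm_entry _ _ _)).
  apply: (le_trans (entry_normM _ _)); rewrite /c -mulrA ler_wpM2l ?nm_ge0//.
  exact: entry_normX.
by apply/cvg_ex; eexists; exact: series_expR_scaled.
Qed.

Let coeff_diffs B A i j : pseries_diffs (coeff B A i j) = coeff (B *m A) A i j.
Proof.
apply/funext => k; rewrite /pseries_diffs /coeff exprS -mulmxE mulmxA.
rewrite factS natrM invfM mulrCA [X in _ * X = _]mulrA divff ?mul1r//.
Qed.

Let coeff_sum B A i j (x : R) :
  limn (pseries (coeff B A i j) x) = (B *m mexp (x *: A)) i j.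
Proof.
apply: cvg_lim => //.
have /(_ i j) := mx_cvgM (mx_cvg_cst B) (mx_sum_cvg (exp_summable (x *: A))).
rewrite /pseries/series/=.
under eq_fun => m do rewrite mulmx_sumr summxE.
under [X in _ -> X @ _ --> _]eq_fun => m do rewrite big_mkord.
rewrite (_ : (fun m => _) = (fun m => \sum_(i0 < m) coeff B A i j i0 * x ^+ i0))//.
apply/funext => m; apply: eq_bigr => k _.
by rewrite mx_exprZ -!scalemxAr mxE mxE /coeff; ring.
Qed.

Lemma mx_derive_mexp A (x : R) :
  mx_derive (fun y => mexp (y *: A)) x (A *m mexp (x *: A)).
Proof.
move=> i j.
have E B : (fun y : R => (B *m mexp (y *: A)) i j) = (fun y => limn (pseries (coeff B A i j) y)).
  by apply/funext => y; rewrite coeff_sum.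
have -> : (fun y : R => mexp (y *: A) i j) = (fun y => limn (pseries (coeff 1%:M A i j) y)).
  by rewrite -E; apply/funext => y; rewrite mul1mx.
rewrite -coeff_sum.
have -> : coeff A A i j = pseries_diffs (coeff 1%:M A i j).
  by rewrite coeff_diffs mul1mx.
apply: (@pseries_snd_diffs _ _ (`|x| + 1)); rewrite ?coeff_diffs; try exact: coeff_cvg.
by rewrite [ltRHS]ger0_norm ?addr_ge0// ltrDl.
Qed.

Lemma mexp_mulN A (x : R) : mexp (x *: A) *m mexp ((- x) *: A) = 1%:M.
Proof.
pose F (y : R) : 'M[R]_n := mexp (y *: A) *m mexp ((- y) *: A).
have -> : mexp (x *: A) *m mexp ((- x) *: A) = F x by [].
rewrite (@mx_derive0_cst _ _ F x 0) /F; first by rewrite oppr0 !scale0r mexp0 mul1mx.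
move=> y; apply: mx_derive_eq; last first.
  apply: mx_deriveM; first exact: mx_derive_mexp.
  apply: (@mx_derive_comp _ _ (fun z => mexp (z *: A)) -%R); first exact: mx_derive_mexp.
have cA : comm_mx A (mexp (y *: A)).
  by apply: comm_mexp; rewrite /comm_mx -scalemxAr -scalemxAl.
by rewrite scaleN1r mulmxN mulmxA -cA subrr.
Qed.

(** Uniqueness for the linear equation Y' = AY with Y(0) = 1: multiply by
    exp(-xA) and differentiate. *)
Lemma mexp_ode {A} {Y : R -> 'M[R]_n} : (forall x, mx_derive Y x (A *m Y x)) ->
  Y 0 = 1%:M -> forall x, Y x = mexp (x *: A).
Proof.
move=> dY Y0 x.
pose F (y : R) : 'M[R]_n := mexp ((- y) *: A) *m Y y.
have Fx : F x = 1%:M.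
  rewrite (@mx_derive0_cst _ _ F x 0) /F; first by rewrite oppr0 !scale0r mexp0 mul1mx.
  move=> y; apply: mx_derive_eq; last first.
    apply: mx_deriveM; last exact: dY.
    apply: (@mx_derive_comp _ _ (fun z => mexp (z *: A)) -%R); first exact: mx_derive_mexp.
  have cA : comm_mx A (mexp ((- y) *: A)).
    by apply: comm_mexp; rewrite /comm_mx -scalemxAr -scalemxAl.
  by rewrite scaleN1r mulNmx cA mulmxA addNr.
by rewrite -[LHS]mul1mx -(mexp_mulN A x) -mulmxA -/(F x) Fx mulmx1.
Qed.

(** x |-> exp(xA) exp(xB) solves the equation that characterizes exp(x(A+B)). *)
Lemma mexpD {A B} : comm_mx A B -> mexp (A + B) = mexp A *m mexp B.
Proof.
move=> AB.
have := @mexp_ode (A + B) (fun x => mexp (x *: A) *m mexp (x *: B)).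
move=> /(_ _ _ 1); rewrite !scale1r => -> //; last by rewrite !scale0r !mexp0 mulmx1.
move=> x; apply: mx_derive_eq; last by apply: mx_deriveM; exact: mx_derive_mexp.
have cB : comm_mx B (mexp (x *: A)).
  by apply: comm_mexp; rewrite /comm_mx -scalemxAr -scalemxAl AB.
by rewrite mulmxDl !mulmxA cB.
Qed.

End MatrixExponential.

(** * Powers t^A and their decay at 0 *)

Lemma unitmx_kernel (F : fieldType) (n : nat) (A : 'M[F]_n) :
  (forall W : 'M[F]_n, W *m A = 0 -> W = 0) -> A \in unitmx.
Proof.
move=> A0; rewrite -row_free_unit -kermx_eq0; apply/eqP.
by apply: A0; exact: mulmx_ker.
Qed.

Lemma powR_le1 (R : realType) (t c : R) : 0 <= t <= 1 -> 0 <= c -> t `^ c <= 1.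
Proof.
move=> /andP[t0 t1] c0; have <- : 1 `^ c = 1 :> R by rewrite powR1.
by apply: ge0_ler_powR; rewrite ?nnegrE.
Qed.

Section MatrixPower.
Context {R : realType} {n : nat}.
Implicit Types (A B D M P : 'M[R]_n) (t : R).

Definition rpow t A : 'M[R]_n := mexp (ln t *: A).

Lemma comm_mxZ A B (x : R) : comm_mx A B -> comm_mx A (x *: B).
Proof. by rewrite /comm_mx -scalemxAr -scalemxAl => ->. Qed.

Lemma comm_rpow {A B} t : comm_mx A B -> comm_mx A (rpow t B).
Proof. by move=> AB; apply: comm_mexp; exact: comm_mxZ. Qed.

Lemma rpow0 t : rpow t 0 = 1%:M.
Proof. by rewrite /rpow scaler0 mexp0. Qed.

Lemma rpow1 A : rpow 1 A = 1%:M.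
Proof. by rewrite /rpow ln1 scale0r mexp0. Qed.

Lemma rpowD {A B} t : comm_mx A B -> rpow t (A + B) = rpow t A *m rpow t B.
Proof.
move=> AB; rewrite /rpow scalerDr mexpD//.
by apply/comm_mxZ/comm_mx_sym/comm_mxZ/comm_mx_sym.
Qed.

Lemma rpowMl {s t} A : 0 < s -> 0 < t -> rpow (s * t) A = rpow s A *m rpow t A.
Proof.
move=> s0 t0; rewrite /rpow lnM ?posrE// scalerDl mexpD//.
by apply/comm_mxZ/comm_mx_sym/comm_mxZ.
Qed.

Lemma rpow_scalar {t} (x : R) : 0 < t -> rpow t x%:M = (t `^ x)%:M.
Proof.
move=> t0; rewrite /rpow -[x%:M]scalemx1 scalerA scalemx1 mexp_scalar.
by rewrite /powR gt_eqF// mulrC.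
Qed.

Lemma rpow_add_scalar {t} A (x : R) : 0 < t ->
  rpow t (A + x%:M) = t `^ x *: rpow t A.
Proof.
move=> t0; rewrite rpowD; last by rewrite /comm_mx scalar_mxC.
by rewrite rpow_scalar// mul_mx_scalar.
Qed.

Lemma rpow_add_nat {t} A (k : nat) : 0 < t ->
  rpow t (A + k%:R%:M) = t ^+ k *: rpow t A.
Proof. by move=> t0; rewrite rpow_add_scalar// powR_mulrn// ltW. Qed.

Lemma rpow_sub1 {t} A : 0 < t -> rpow t (A - 1%:M) = t^-1 *: rpow t A.
Proof.
by move=> t0; rewrite -scaleN1r scalemx1 rpow_add_scalar// powR_inv1// ltW.
Qed.

Lemma rpow_mulN A t : rpow t A *m rpow t (- A) = 1%:M.
Proof. by rewrite /rpow scalerN -scaleNr mexp_mulN. Qed.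

Lemma mx_derive_rpow {t} A : 0 < t ->
  mx_derive (fun s => rpow s A) t (A *m rpow t (A - 1%:M)).
Proof.
move=> t0; apply: mx_derive_eq; last first.
  apply: (@mx_derive_comp _ _ (fun x => mexp (x *: A)) (@ln R)).
    exact: mx_derive_mexp.
  exact: is_derive1_ln.
by rewrite rpow_sub1// scalemxAr.
Qed.

Lemma mx_derive_rpow_onem {t} A : t < 1 ->
  mx_derive (fun s => rpow (1 - s) A) t (- (A *m rpow (1 - t) (A - 1%:M))).
Proof.
move=> t1; apply: mx_derive_eq; last first.
  apply: (@mx_derive_comp _ _ (fun x => rpow x A) (fun s => 1 - s)).
    by apply: mx_derive_rpow; rewrite subr_gt0.
by rewrite add0r mul1r scaleN1r.
Qed.

Lemma rpow_norm_ge1 A t : 1 <= t -> nm (rpow t A) <= (1 + n%:R) * t `^ (nm A).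
Proof.
move=> t1; apply: (le_trans (mexp_norm_le _)).
rewrite entry_normZ ger0_norm ?ln_ge0// /powR gt_eqF ?(lt_le_trans _ t1)//.
by rewrite mulrC (mulrC (ln t)) mulrC.
Qed.

(** The quantitative form of positive stability used in all estimates: it is
    what makes t^(A-1) integrable at 0.  Having c <= 1 costs nothing and gives
    t^c <= t for t >= 1. *)
Definition mx_stable A := exists c K : R, [/\ 0 < c <= 1, 0 <= K &
  forall t, 0 < t <= 1 -> nm (rpow t A) <= K * t `^ c].

(** The limit case c = 0, which includes A = 0. *)
Definition rpow_bounded A := exists2 K : R, 0 <= K &
  forall t, 0 < t <= 1 -> nm (rpow t A) <= K.

Lemma mx_stable_bounded {A} : mx_stable A -> rpow_bounded A.
Proof.
move=> [c [K [/andP[c0 c1] K0 AK]]]; exists K => // t /[dup] t01 /andP[t0 t1].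
apply: (le_trans (AK _ t01)); rewrite ler_piMr//.
by rewrite powR_le1 ?(ltW c0) ?(ltW t0).
Qed.

Lemma rpow_bounded0 : rpow_bounded 0.
Proof. by exists n%:R => // t _; rewrite rpow0 entry_norm1. Qed.

Lemma rpow_bounded_stable {A} : rpow_bounded A -> mx_stable (A + 1%:M).
Proof.
move=> [K K0 AK]; exists 1, K; split => //; first by rewrite ltr01 lexx.
move=> t /[dup] t01 /andP[t0 t1].
rewrite rpow_add_scalar// entry_normZ ger0_norm ?powR_ge0// mulrC.
by rewrite ler_wpM2r ?powR_ge0// AK.
Qed.

Lemma mx_stable1 : mx_stable 1%:M.
Proof. by rewrite -[1%:M]add0r; apply: rpow_bounded_stable; exact: rpow_bounded0. Qed.

Lemma mx_stableD {A B} : comm_mx A B -> mx_stable A -> rpow_bounded B -> mx_stable (A + B).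
Proof.
move=> AB [c [K [c01 K0 AK]]] [K' K'0 BK]; exists c, (K * K').
split => // [|t t01]; first exact: mulr_ge0.
rewrite rpowD// (le_trans (entry_normM _ _))// [leRHS]mulrAC.
by apply: ler_pM; [exact: nm_ge0|exact: nm_ge0|exact: AK|exact: BK].
Qed.

(** If WA = 0 then W t^A = W for every t, whereas t^A is small near 0. *)
Lemma mx_stable_unit {A} : mx_stable A -> A \in unitmx.
Proof.
move=> [c [K [/andP[c0 _] K0 AK]]]; apply: unitmx_kernel => W WA.
have WE t : W *m rpow t A = W.
  rewrite /rpow (@mx_derive0_cst _ _ (fun x => W *m mexp (x *: A)) _ 0).
    by rewrite scale0r mexp0 mulmx1.
  move=> x; apply: mx_derive_eq; last first.
    by apply: mx_deriveM; [exact: mx_derive_cst|exact: mx_derive_mexp].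
  by rewrite mul0mx add0r mulmxA WA mul0mx.
(* small enough for the bound on t^A to be at most 1/2 *)
pose e : R := (2 * (K + 1))^-1; pose t := e `^ c^-1.
have K1 : 0 < K + 1 by rewrite ltr_wpDl.
have e0 : 0 < e by rewrite invr_gt0 mulr_gt0.
have e1 : e <= 1 by rewrite invf_le1 ?mulr_gt0//; lra.
have t01 : 0 < t <= 1.
  by rewrite powR_gt0//= powR_le1 ?(ltW e0)// invr_ge0 ltW.
apply: entry_norm_eq0.
have : nm W <= nm W * 2^-1.
  rewrite -{1}(WE t) (le_trans (entry_normM _ _))// ler_wpM2l ?nm_ge0//.
  apply: (le_trans (AK _ t01)).
  rewrite /t -powRrM mulVf ?gt_eqF// powRr1; last exact: ltW.
  rewrite /e.
  rewrite ler_pdivrMr ?mulr_gt0// mulrA mulVf// mul1r; lra.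
lra.
Qed.

(** A geometric bound on the powers of P = 1 - hA gives stability, because
    t^A = t^(1/h) exp(y P) where y = - ln t / h >= 0. *)
Lemma power_bounded_stable {A} {h r c : R} : 0 < h -> r < 1 -> 0 <= c ->
  (forall k, nm ((1%:M - h *: A) ^+ k) <= c * r ^+ k) -> mx_stable A.
Proof.
move=> h0 r1 c0 Pc; set P := 1%:M - h *: A in Pc.
pose d := (1 - r) / h; have d0 : 0 < d by rewrite divr_gt0// subr_gt0.
exists (Num.min d 1), c; split => //.
  by rewrite lt_min d0 ltr01/= ge_min lexx orbT.
move=> t /[dup] t01 /andP[t0 t1].
pose y := - ln t / h.
have y0 : 0 <= y by rewrite divr_ge0 ?oppr_ge0 ?ln_le0// ltW.
have -> : rpow t A = expR (- y) *: mexp (y *: P).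
  have yE : ln t *: A = y *: P + (- y)%:M.
    rewrite /P scalerBr scalemx1 scalerA /y divfK ?gt_eqF//.
    by rewrite raddfN/= addrAC subrr add0r scaleNr opprK.
  rewrite /rpow yE mexpD; last by rewrite /comm_mx scalar_mxC.
  by rewrite mexp_scalar mul_mx_scalar.
rewrite entry_normZ ger0_norm ?expR_ge0//.
apply: (le_trans (ler_wpM2l (expR_ge0 _) (mexp_norm_power_le y0 Pc))).
rewrite mulrCA ler_wpM2l// -expRD.
apply: (@le_trans _ _ (t `^ d)); last first.
  by rewrite ger_powR ?t0// ge_min lexx.
rewrite /powR gt_eqF// ler_expR /y /d.
by rewrite le_eqVlt; apply/orP; left; apply/eqP; field; exact: lt0r_neq0.
Qed.

End MatrixPower.

(** * Integrals over open intervals from a primitive *)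

Section PrimitiveOnOpenInterval.
Context {R : realType}.
Notation mu := (@lebesgue_measure R).
Implicit Types (f F : R -> R).

Lemma continuous_on_measurable {D : set R} {f} : measurable D ->
  (forall t, D t -> {for t, continuous f}) -> measurable_fun D f.
Proof.
move=> mD cf; apply: subspace_continuous_measurable_fun => //.
by apply: continuous_in_subspaceT => t /[!inE] Dt; exact: cf.
Qed.

Lemma integral_segment_primitive f F (a b : R) : a < b ->
  (forall t, a <= t <= b -> is_derive t (1 : R) F (f t)) ->
  (forall t, a <= t <= b -> {for t, continuous f}) ->
  (\int[mu]_(x in `[a, b]) (f x)%:E = (F b - F a)%:E)%E.
Proof.
move=> ab dF cf.
have F_cont t : a <= t <= b -> {for t, continuous F}.
  by move=> /dF[dFt _]; exact/differentiable_continuous/derivable1_diffP.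
rewrite (@continuous_FTC2 _ f F a b)//.
- by apply: continuous_in_subspaceT => t /[!inE]/=; rewrite in_itv/=; exact: cf.
- split.
  + move=> t /[!in_itv]/= /andP[a_t tb].
    by have [] := dF t (introT andP (conj (ltW a_t) (ltW tb))).
  + by apply: cvg_at_right_filter; apply: F_cont; rewrite lexx ltW.
  + by apply: cvg_at_left_filter; apply: F_cont; rewrite lexx ltW.
- move=> t /[!in_itv]/= /andP[a_t tb].
  by have [_ <-] := dF t (introT andP (conj (ltW a_t) (ltW tb))); rewrite derive1E.
Qed.

(** An open interval exhausted by segments, on which improper integrals are
    evaluated from a primitive. *)
Variables (D : set R) (x y : nat -> R).
Hypothesis xy : forall k, x k < y k.
Hypothesis x_dec : {homo x : k l / (k <= l)%N >-> l <= k}.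
Hypothesis y_inc : {homo y : k l / (k <= l)%N >-> k <= l}.
Hypothesis DE : D = \bigcup_k `[x k, y k]%classic.

Let D_segment k t : x k <= t <= y k -> D t.
Proof. by move=> xty; rewrite DE; exists k => //=; rewrite in_itv. Qed.

Let mD : measurable D.
Proof. by rewrite DE; exact: bigcup_measurable. Qed.

(** The integrals over the exhausting segments are increments of [F], hence at
    most [c + c]; they increase to the integral over [D]. *)
Lemma integrable_bounded_primitive f F (c : R) :
  (forall t, D t -> is_derive t (1 : R) F (f t)) ->
  (forall t, D t -> {for t, continuous f}) ->
  (forall t, D t -> 0 <= f t) -> (forall t, D t -> `|F t| <= c) ->
  mu.-integrable D (EFin \o f).
Proof.
move=> dF cf f0 Fc.
have mf := continuous_on_measurable mD cf.
apply/integrableP; split; first exact/measurable_EFinP.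
have -> : (\int[mu]_(t in D) `|(EFin \o f) t| = \int[mu]_(t in D) (EFin \o f) t)%E.
  by apply: eq_integral => t /[!inE] Dt /=; rewrite ger0_norm// f0.
have Dk k : `[x k, y k] `<=` D.
  by move=> z /=; rewrite in_itv/=; exact: D_segment.
have lim : (\int[mu]_(t in `[x k, y k]) (EFin \o f) t)%E @[k --> \oo] -->
    (\int[mu]_(t in D) (EFin \o f) t)%E.
  rewrite DE; apply: ge0_nondecreasing_set_cvg_integral => //.
  - move=> k l kl; apply/subsetPset => t /=; rewrite !in_itv/= => /andP[xt ty].
    by rewrite (le_trans (x_dec _ _ kl) xt) (le_trans ty (y_inc _ _ kl)).
  - by move=> k; apply/measurable_EFinP; exact: (measurable_funS mD (Dk k) mf).
  - by move=> k t /Dk Dt; rewrite lee_fin f0.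
apply: (@le_lt_trans _ _ (c + c)%:E); last exact: ltry.
rewrite -(cvg_lim _ lim)//; apply: lime_le; first by apply: cvgP lim.
apply: nearW => k /=.
have -> : (\int[mu]_(t in `[x k, y k]) (f t)%:E = (F (y k) - F (x k))%:E)%E.
  apply: integral_segment_primitive => //.
  - by move=> t /D_segment; exact: dF.
  - by move=> t /D_segment; exact: cf.
have Dx : D (x k) by apply: (@D_segment k); rewrite lexx ltW.
have Dy : D (y k) by apply: (@D_segment k); rewrite lexx ltW.
rewrite lee_fin (le_trans (ler_norm _))// (le_trans (ler_normB _ _))//.
by rewrite lerD ?Fc.
Qed.

(** Dominated convergence along the segments; only the limits of [F] along their
    end points enter, so [F] may be singular there. *)
Lemma integral_primitive_limits f F (lx ly : R) :
  (forall t, D t -> is_derive t (1 : R) F (f t)) ->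
  (forall t, D t -> {for t, continuous f}) ->
  mu.-integrable D (EFin \o f) ->
  F (x k) @[k --> \oo] --> lx -> F (y k) @[k --> \oo] --> ly ->
  \int[mu]_(t in D) f t = ly - lx.
Proof.
move=> dF cf fi Fx Fy.
have mf := continuous_on_measurable mD cf.
have Dk k : `[x k, y k] `<=` D.
  by move=> z /=; rewrite in_itv/=; exact: D_segment.
pose f_ k := (EFin \o f) \_ `[x k, y k].
have mf_ k : measurable_fun D (f_ k).
  apply/measurable_restrict => //.
  by rewrite setIidr//; apply/measurable_EFinP; exact: (measurable_funS mD (Dk k) mf).
have f_f t : D t -> f_ ^~ t @ \oo --> (EFin \o f) t.
  rewrite {1}DE => -[k _ /=]; rewrite in_itv/= => /andP[xt ty].
  apply: cvg_near_cst; exists k => // l /= kl.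
  rewrite /f_ patchE mem_set//= in_itv/=.
  by rewrite (le_trans (x_dec _ _ kl) xt) (le_trans ty (y_inc _ _ kl)).
have f_le t k : D t -> (`|f_ k t| <= (abse \o (EFin \o f)) t)%E.
  by move=> Dt; rewrite /f_ patchE; case: ifP => //= _; rewrite ?normr0 lee_fin.
have [||_ _ lim] := @dominated_convergence _ _ R mu D mD f_ (EFin \o f)
  (abse \o (EFin \o f)) mf_ (measurable_int _ fi) _ (integrable_abse fi) _.
- exact: aeW.
- exact: aeW.
have : (\int[mu]_(t in D) f_ k t)%E @[k --> \oo] --> (ly - lx)%:E.
  have -> : (fun k => \int[mu]_(t in D) f_ k t)%E = (fun k => (F (y k) - F (x k))%:E).
    apply/funext => k; rewrite /f_ -integral_mkcondr setIidr//.
    apply: (@integral_segment_primitive f F) => //.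
    - by move=> t /D_segment; exact: dF.
    - by move=> t /D_segment; exact: cf.
  by apply: cvg_EFin; [exact: nearW|exact: cvgB].
move=> /(cvg_unique _ lim) => /(_ (@ereal_hausdorff _)) E.
by rewrite /Rintegral E.
Qed.

End PrimitiveOnOpenInterval.

Section Exhaustions.
Context {R : realType}.

(** With the shift by 3 the segment from [left_unit k] to [1 - left_unit k] is
    nondegenerate from k = 0 on. *)
Definition left_unit (k : nat) : R := k.+3%:R^-1.

Lemma left_unit_cvg : left_unit k @[k --> \oo] --> 0.
Proof.
have := @cvg_harmonic R; rewrite -(cvg_shiftn 2).
by apply: cvg_trans; apply: near_eq_cvg; apply: nearW => k; rewrite /harmonic/= addn2.
Qed.

Lemma left_unit_itv k : 0 < left_unit k < 1 - left_unit k.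
Proof.
have k0 : 0 < k.+3%:R^-1 :> R by rewrite invr_gt0.
have k3 : k.+3%:R^-1 <= 3^-1 :> R by rewrite lef_pV2 ?posrE// ler_nat.
rewrite /left_unit; move: (k.+3%:R^-1) k0 k3 => u u0 u3.
by rewrite u0/=; lra.
Qed.

Lemma left_unit_dec : {homo left_unit : k l / (k <= l)%N >-> l <= k}.
Proof. by move=> k l kl; rewrite /left_unit lef_pV2 ?posrE// ler_nat. Qed.

Lemma left_unit_small {t : R} : 0 < t -> exists k, left_unit k <= t.
Proof.
move=> t0; exists (Num.truncn t^-1); rewrite /left_unit -[leRHS]invrK.
rewrite lef_pV2 ?posrE ?invr_gt0//.
by rewrite (le_trans (ltW (truncnS_gt _)))// ler_nat !ltnS leqW // leqW.
Qed.

Lemma unit_interval_exhaustion :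
  `]0, 1[%classic = \bigcup_k `[left_unit k, 1 - left_unit k]%classic :> set R.
Proof.
apply/seteqP; split => t /=.
  rewrite in_itv/= => /andP[t0 t1].
  have [k kt] := left_unit_small t0.
  have [l lt] : exists l, left_unit l <= 1 - t by apply: left_unit_small; lra.
  exists (maxn k l) => //=; rewrite in_itv/=.
  have h1 := left_unit_dec _ _ (leq_maxl k l).
  have h2 := left_unit_dec _ _ (leq_maxr k l).
  by apply/andP; split; lra.
by move=> [k _ /=]; rewrite !in_itv/= => /andP[kt tk]; have := left_unit_itv k; lra.
Qed.

Lemma positive_half_line_exhaustion :
  `]0, +oo[%classic = \bigcup_k `[left_unit k, k.+1%:R]%classic :> set R.
Proof.
apply/seteqP; split => t /=.
  rewrite in_itv/= andbT => t0.
  have [k kt] := left_unit_small t0.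
  exists (maxn k (Num.truncn t)) => //=; rewrite in_itv/=.
  rewrite (le_trans (left_unit_dec _ _ (leq_maxl k _)) kt)/=.
  by rewrite (le_trans (ltW (truncnS_gt _)))// ler_nat ltnS leq_maxr.
move=> [k _ /=]; rewrite !in_itv/= andbT => /andP[kt _].
by rewrite (lt_le_trans _ kt)//; case/andP: (left_unit_itv k).
Qed.

End Exhaustions.

(** * Entrywise integrals *)

Section EntrywiseIntegral.
Context {R : realType} {n : nat}.
Notation mu := (@lebesgue_measure R).
Implicit Types (D : set R) (F G : R -> 'M[R]_n) (M : 'M[R]_n).

Definition entry_measurable D F := forall i j, measurable_fun D (fun t => F t i j).

Definition entry_integrable D F :=
  forall i j, mu.-integrable D (EFin \o (fun t => F t i j)).

Definition entry_integral D F : 'M[R]_n :=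
  \matrix_(i, j) \int[mu]_(t in D) F t i j.

Lemma entry_measurable_derive {D F} : measurable D ->
  (forall t, D t -> exists M, mx_derive F t M) -> entry_measurable D F.
Proof.
move=> mD dF i j; apply: continuous_on_measurable => // t /dF[M FM].
exact: mx_derive_continuous FM.
Qed.

Lemma entry_measurable_cst D M : entry_measurable D (fun=> M).
Proof. by move=> i j; exact: measurable_cst. Qed.

Lemma entry_measurableM {D F G} : entry_measurable D F -> entry_measurable D G ->
  entry_measurable D (fun t => F t *m G t).
Proof.
move=> mF mG i j; under eq_fun do rewrite mxE.
by apply: measurable_sum => k; apply: measurable_funM; [exact: mF|exact: mG].
Qed.

Lemma entry_measurableZ {D} {c : R -> R} {F} : measurable_fun D c -> entry_measurable D F ->
  entry_measurable D (fun t => c t *: F t).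
Proof.
move=> mc mF i j; under eq_fun do rewrite mxE.
by apply: measurable_funM => //; exact: mF.
Qed.

Lemma entry_measurable_sum {D} m {F : nat -> R -> 'M[R]_n} :
  (forall k, entry_measurable D (F k)) ->
  entry_measurable D (fun t => \sum_(k < m) F k t).
Proof.
move=> mF i j; under eq_fun do rewrite summxE.
by apply: measurable_sum => k; exact: mF.
Qed.

Lemma entry_integrable_le {D F} {g : R -> R} : measurable D -> entry_measurable D F ->
  mu.-integrable D (EFin \o g) -> (forall t, D t -> nm (F t) <= g t) ->
  entry_integrable D F.
Proof.
move=> mD mF ig Fg i j; apply: le_integrable ig => //.
  by apply/measurable_EFinP; exact: mF.
move=> t Dt /=; rewrite lee_fin (le_trans (entry_norm_entry _ i j))//.
by rewrite (le_trans (Fg t Dt))// ler_norm.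
Qed.

Lemma eq_entry_integrable {D} F {G} : measurable D -> (forall t, D t -> F t = G t) ->
  entry_integrable D F -> entry_integrable D G.
Proof.
move=> mD FG iF i j; apply: eq_integrable (iF i j) => //.
by move=> t /[!inE] Dt /=; rewrite FG.
Qed.

Lemma eq_entry_integral {D F} G : (forall t, D t -> F t = G t) ->
  entry_integral D F = entry_integral D G.
Proof.
move=> FG; apply/matrixP => i j; rewrite !mxE; apply: eq_Rintegral.
by move=> t /[!inE] Dt; rewrite FG.
Qed.

Lemma integrable_bigsum {D} {I : Type} (r : seq I) {f : I -> R -> R} : measurable D ->
  (forall i, mu.-integrable D (EFin \o f i)) ->
  mu.-integrable D (EFin \o (fun t => \sum_(i <- r) f i t)) /\
  \int[mu]_(t in D) (\sum_(i <- r) f i t) = \sum_(i <- r) \int[mu]_(t in D) f i t.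
Proof.
move=> mD fi; elim: r => [|i r [IHi IH]].
  split; last by rewrite big_nil; under eq_Rintegral do rewrite big_nil; rewrite Rintegral_cst// mul0r.
  apply: (@eq_integrable _ _ _ mu _ mD (cst 0%E)); last exact: integrable0.
  by move=> t _ /=; rewrite big_nil.
split.
  apply: (@eq_integrable _ _ _ mu _ mD ((EFin \o f i) \+ (EFin \o (fun t => (\sum_(i <- r) f i t)%R)))%E).
    by move=> t _ /=; rewrite big_cons.
  exact: integrableD.
rewrite big_cons -IH -RintegralD//.
by apply: eq_Rintegral => t _; rewrite big_cons.
Qed.

Lemma integrable_scale {D} (c : R) {f : R -> R} : measurable D ->
  mu.-integrable D (EFin \o f) -> mu.-integrable D (EFin \o (fun t => c * f t)).
Proof.
move=> mD fi; apply: (@eq_integrable _ _ _ mu _ mD (fun t => (c%:E * (EFin \o f) t)%E)).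
  by move=> t _ /=; rewrite EFinM.
exact: integrableZl.
Qed.

Lemma entry_integral_mull {D F} M : measurable D -> entry_integrable D F ->
  entry_integrable D (fun t => M *m F t) /\
  entry_integral D (fun t => M *m F t) = M *m entry_integral D F.
Proof.
move=> mD iF.
have H i j k : mu.-integrable D (EFin \o (fun t => M i k * F t k j)).
  exact: (integrable_scale _ mD (iF k j)).
split=> [i j|].
  have [+ _] := integrable_bigsum (index_enum _) mD (H i j).
  by under [X in _ -> _.-integrable _ (_ \o X)]eq_fun do rewrite mxE.
apply/matrixP => i j; rewrite !mxE.
under eq_Rintegral do rewrite mxE.
have [_ ->] := integrable_bigsum (index_enum _) mD (H i j).
by apply: eq_bigr => k _; rewrite mxE RintegralZl.
Qed.

Lemma entry_integral_mulr {D F} M : measurable D -> entry_integrable D F ->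
  entry_integrable D (fun t => F t *m M) /\
  entry_integral D (fun t => F t *m M) = entry_integral D F *m M.
Proof.
move=> mD iF.
have H i j k : mu.-integrable D (EFin \o (fun t => F t i k * M k j)).
  under eq_fun do rewrite mulrC.
  exact: (integrable_scale _ mD (iF i k)).
split=> [i j|].
  have [+ _] := integrable_bigsum (index_enum _) mD (H i j).
  by under [X in _ -> _.-integrable _ (_ \o X)]eq_fun do rewrite mxE.
apply/matrixP => i j; rewrite !mxE.
under eq_Rintegral do rewrite mxE.
have [_ ->] := integrable_bigsum (index_enum _) mD (H i j).
by apply: eq_bigr => k _; rewrite mxE RintegralZr.
Qed.

Lemma entry_integralD {D F G} : measurable D -> entry_integrable D F -> entry_integrable D G ->
  entry_integrable D (fun t => F t + G t) /\
  entry_integral D (fun t => F t + G t) = entry_integral D F + entry_integral D G.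
Proof.
move=> mD iF iG; split=> [i j|].
  apply: (@eq_integrable _ _ _ mu _ mD ((EFin \o (fun t => F t i j)) \+ (EFin \o (fun t => G t i j)))%E).
    by move=> t _ /=; rewrite mxE.
  exact: integrableD.
apply/matrixP => i j; rewrite !mxE -RintegralD//.
by apply: eq_Rintegral => t _; rewrite mxE.
Qed.

Lemma entry_integral_sum {D} m (F : nat -> R -> 'M[R]_n) : measurable D ->
  (forall k, entry_integrable D (F k)) ->
  entry_integral D (fun t => \sum_(k < m) F k t) = \sum_(k < m) entry_integral D (F k).
Proof.
move=> mD iF; apply/matrixP => i j; rewrite mxE summxE.
under eq_Rintegral do rewrite summxE.
have [_ ->] := integrable_bigsum (index_enum 'I_m) mD (fun k => iF k i j).
by apply: eq_bigr => k _; rewrite mxE.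
Qed.

Lemma entry_integral_comm {D F M} : measurable D -> entry_integrable D F ->
  (forall t, D t -> comm_mx M (F t)) -> comm_mx M (entry_integral D F).
Proof.
move=> mD iF MF; have [_ El] := entry_integral_mull M mD iF.
have [_ Er] := entry_integral_mulr M mD iF.
by rewrite /comm_mx -El -Er; exact: eq_entry_integral.
Qed.

Lemma entry_dominated_cvg {D} {F_ : nat -> R -> 'M[R]_n} {F} {g : R -> R} : measurable D ->
  (forall k, entry_measurable D (F_ k)) -> entry_measurable D F ->
  mu.-integrable D (EFin \o g) ->
  (forall t k, D t -> nm (F_ k t) <= g t) ->
  (forall t, D t -> F_ ^~ t ~> F t) ->
  entry_integrable D F /\ (fun k => entry_integral D (F_ k)) ~> entry_integral D F.
Proof.
move=> mD mF_ mF ig F_g F_F.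
have iF : entry_integrable D F.
  apply: entry_integrable_le ig _ => // t Dt.
  by apply: (mx_cvg_norm_le (F_F t Dt)) => k; exact: F_g.
split => // i j; rewrite mxE; under eq_fun do rewrite mxE.
have [||_ _ lim] := @dominated_convergence _ _ R mu D mD
  (fun k => EFin \o (fun t => F_ k t i j)) (EFin \o (fun t => F t i j)) (EFin \o g)
  (fun k => (measurable_EFinP _ _).2 (mF_ k i j)) (measurable_int _ (iF i j)) _ ig _.
- apply: aeW => t Dt; apply: cvg_EFin; first exact: nearW.
  exact: F_F.
- apply: aeW => t k Dt /=; rewrite lee_fin.
  by rewrite (le_trans (entry_norm_entry _ i j))// F_g.
rewrite /Rintegral; apply: fine_cvg; rewrite fineK//.
exact: (@integrable_fin_num _ _ _ mu D mD _ (iF i j)).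
Qed.

End EntrywiseIntegral.

(** * Scalar dominating functions *)

Section Dominators.
Context {R : realType}.
Notation mu := (@lebesgue_measure R).

Lemma powR_continuous (c t : R) : 0 < t -> {for t, continuous (fun s : R => s `^ c)}.
Proof.
move=> t0; apply/differentiable_continuous/derivable1_diffP.
by apply: derivable_powR; rewrite in_itv/= t0.
Qed.

Lemma beta_dominator_integrable (c d : R) : 0 < c -> 0 < d ->
  mu.-integrable `]0, 1[ (EFin \o (fun t => t `^ (c - 1) + (1 - t) `^ (d - 1))).
Proof.
move=> c0 d0.
have dP (t : R) : `]0, 1[%classic t -> 0 < t /\ 0 < 1 - t.
  by rewrite /= in_itv/= subr_gt0 => /andP[].
have donem (t : R) : is_derive t (1 : R) (fun s => 1 - s) (- 1).
  by apply: is_derive_eq; rewrite add0r mul1r.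
apply: (@integrable_bounded_primitive _ _ left_unit (fun k => 1 - left_unit k)
   _ left_unit_dec _ unit_interval_exhaustion _
  (fun t => c^-1 * t `^ c - d^-1 * (1 - t) `^ d) (c^-1 + d^-1)).
- by move=> k; case/andP: (@left_unit_itv R k).
- by move=> k l kl; rewrite lerB// left_unit_dec.
- move=> t /dP[t0 t1].
  have dc := is_derive1_powR c t0.
  have dd : is_derive t (1 : R) (fun s => (1 - s) `^ d) (d * (1 - t) `^ (d - 1) * -1).
    exact: (@is_derive1_comp _ (fun s : R => s `^ d) (fun s => 1 - s) _ _ _ (is_derive1_powR d t1)).
  have dF := is_deriveB (is_deriveZ c^-1 dc) (is_deriveZ d^-1 dd).
  apply: (is_derive_eq dF).
  by rewrite /GRing.scale/= mulrN1 !mulrN opprK !mulrA !mulVf ?mul1r ?gt_eqF.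
- move=> t /dP[t0 t1]; apply: continuousD; first exact: powR_continuous.
  apply: (@continuous_comp _ _ _ (fun s : R => 1 - s) (fun s : R => s `^ (d - 1))).
    by apply: continuousB; [exact: cst_continuous|exact: cvg_id].
  exact: powR_continuous.
- by move=> t _; rewrite addr_ge0 ?powR_ge0.
- move=> t /dP[t0 t1]; rewrite (le_trans (ler_normB _ _))//.
  have c1 : 0 <= c^-1 by rewrite invr_ge0 ltW.
  have d1 : 0 <= d^-1 by rewrite invr_ge0 ltW.
  rewrite !ger0_norm ?mulr_ge0 ?powR_ge0//.
  rewrite lerD// ler_piMr// powR_le1 ?(ltW c0) ?(ltW d0)//; apply/andP; split; lra.
Qed.

(** A function with a bounded elementary primitive, of order t^(c-1) at 0 and
    t^(-1-c) at infinity: multiples of it dominate Gamma integrands on the whole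
    half line. *)
Lemma gamma_dominator_integrable (c : R) : 0 < c ->
  mu.-integrable `]0, +oo[ (EFin \o (fun t => t `^ (c - 1) * (1 + t `^ c) ^- 2)).
Proof.
move=> c0.
have dP (t : R) : `]0, +oo[%classic t -> 0 < t by rewrite /= in_itv/= andbT.
have p1 (t : R) : 1 + t `^ c != 0 by rewrite gt_eqF// ltr_wpDr ?powR_ge0.
apply: (@integrable_bounded_primitive _ _ left_unit (fun k => k.+1%:R)
   _ left_unit_dec _ positive_half_line_exhaustion _
  (fun t => - c^-1 * (1 + t `^ c)^-1) c^-1).
- move=> k; rewrite (@lt_le_trans _ _ 1)//; last by rewrite ler1n.
  by have /andP[? ?] := @left_unit_itv R k; lra.
- by move=> k l kl; rewrite ler_nat.
- move=> t /dP t0.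
  have d1 := is_deriveD (is_derive_cst (1 : R) t (1 : R)) (is_derive1_powR c t0).
  have dF := is_deriveZ (- c^-1) (@is_deriveV _ (fun s : R => 1 + s `^ c) _ _ _ (p1 t) d1).
  apply: (is_derive_eq dF).
  rewrite /GRing.scale/= add0r; move: (p1 t); set q := 1 + _ => q0.
  by field; rewrite q0 gt_eqF.
- move=> t /dP t0; apply: continuousM; first exact: powR_continuous.
  apply: continuousV; first by rewrite expf_neq0.
  apply: (@continuous_comp _ _ _ (fun s : R => 1 + s `^ c) (fun u : R => u ^+ 2)); last exact: exprn_continuous.
  by apply: continuousD; [exact: cst_continuous|exact: powR_continuous].
- by move=> t _; rewrite mulr_ge0 ?powR_ge0// invr_ge0 exprn_ge0// addr_ge0 ?powR_ge0.
- move=> t _; have c1 : 0 <= c^-1 by rewrite invr_ge0 ltW.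
  rewrite normrM normrN (ger0_norm c1) ler_piMr//.
  rewrite ger0_norm ?invr_ge0 ?addr_ge0 ?powR_ge0//.
  by rewrite invf_le1 ?ltr_wpDr ?powR_ge0// lerDl powR_ge0.
Qed.

End Dominators.

(** * The matrix Beta and Gamma integrals *)

Lemma powR_sub1 (R : realType) (t c : R) : 0 < t -> t `^ (c - 1) = t `^ c / t.
Proof.
by move=> t0; rewrite powRD ?(gt_eqF t0) ?implybT// powR_inv1 ?(ltW t0).
Qed.

Definition beta_integrand {R : realType} {n} (A D : 'M[R]_n) (t : R) : 'M[R]_n :=
  rpow t (A - 1%:M) *m rpow (1 - t) (D - 1%:M).

Definition gamma_integrand {R : realType} {n} (A : 'M[R]_n) (t : R) : 'M[R]_n :=
  expR (- t) *: rpow t (A - 1%:M).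

(* locked, lest unification compare two integrals by unfolding them *)
HB.lock Definition mbeta {R : realType} {n} (A D : 'M[R]_n) : 'M[R]_n :=
  entry_integral `]0, 1[ (beta_integrand A D).

HB.lock Definition mgamma {R : realType} {n} (A : 'M[R]_n) : 'M[R]_n :=
  entry_integral `]0, +oo[ (gamma_integrand A).

Section BetaGamma.
Context {R : realType} {n : nat}.
Notation mu := (@lebesgue_measure R).
Implicit Types (A D M : 'M[R]_n).

Lemma unit_itvP {t : R} : `]0, 1[%classic t -> 0 < t /\ t < 1.
Proof. by rewrite /= in_itv/= => /andP[]. Qed.

Lemma half_lineP {t : R} : `]0, +oo[%classic t -> 0 < t.
Proof. by rewrite /= in_itv/= andbT. Qed.

Lemma rpow_measurable (S : set R) A : measurable S -> (forall t, S t -> 0 < t) ->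
  entry_measurable S (fun t => rpow t A).
Proof.
move=> mS S0; apply: entry_measurable_derive => // t /S0 t0.
by eexists; exact: mx_derive_rpow.
Qed.

Lemma mx_derive_beta_integrand A D {t : R} : 0 < t -> t < 1 ->
  exists M, mx_derive (beta_integrand A D) t M.
Proof.
move=> t0 t1; eexists; apply: mx_deriveM; first exact: mx_derive_rpow.
exact: mx_derive_rpow_onem.
Qed.

Lemma beta_measurable A D : entry_measurable `]0, 1[ (beta_integrand A D).
Proof.
apply: entry_measurable_derive => // t /unit_itvP[t0 t1].
exact: mx_derive_beta_integrand.
Qed.

Lemma rpow_sub1_norm_le {A} {c K : R} :
  (forall t, 0 < t <= 1 -> nm (rpow t A) <= K * t `^ c) ->
  forall t, 0 < t <= 1 -> nm (rpow t (A - 1%:M)) <= K * t `^ (c - 1).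
Proof.
move=> AK t /[dup] t01 /andP[t0 t1].
rewrite rpow_sub1// entry_normZ ger0_norm ?invr_ge0 ?(ltW t0)//.
rewrite powR_sub1// mulrA mulrC.
by rewrite ler_wpM2r ?invr_ge0 ?(ltW t0)// AK.
Qed.

Lemma powR_sub1_half (s d : R) : 2^-1 <= s <= 1 -> 0 <= d -> s `^ (d - 1) <= 2.
Proof.
move=> /andP[s2 s1] d0; have s0 : 0 < s by rewrite (lt_le_trans _ s2).
rewrite powR_sub1//.
rewrite ler_pdivrMr// (@le_trans _ _ 1)//; last lra.
by rewrite powR_le1// s1 ltW.
Qed.

(** One of t and 1 - t is at least 1/2, and its power is then at most 2; the sum
    of the two singular powers therefore dominates their product. *)
Lemma beta_dominator_le (c d t : R) : 0 <= c -> 0 <= d -> 0 < t -> t < 1 ->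
  t `^ (c - 1) * (1 - t) `^ (d - 1) <= 2 * (t `^ (c - 1) + (1 - t) `^ (d - 1)).
Proof.
move=> c0 d0 t0 t1.
have := powR_ge0 t (c - 1); have := powR_ge0 (1 - t) (d - 1).
have [t2|t2] := leP t 2^-1.
  have : (1 - t) `^ (d - 1) <= 2 by apply: powR_sub1_half => //; apply/andP; split; lra.
  by move: (t `^ _) ((1 - t) `^ _) => p q; nra.
have : t `^ (c - 1) <= 2 by apply: powR_sub1_half => //; apply/andP; split; lra.
by move: (t `^ _) ((1 - t) `^ _) => p q; nra.
Qed.

Lemma beta_dominated {A D} : mx_stable A -> mx_stable D ->
  exists2 g : R -> R, mu.-integrable `]0, 1[ (EFin \o g) &
    forall t, `]0, 1[%classic t -> nm (beta_integrand A D t) <= g t.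
Proof.
move=> [c [K [/andP[c0 _] K0 AK]]] [d [K' [/andP[d0 _] K'0 DK]]].
exists (fun t => K * K' * 2 * (t `^ (c - 1) + (1 - t) `^ (d - 1))).
  by apply: integrable_scale => //; exact: beta_dominator_integrable.
move=> t /unit_itvP[t0 t1]; apply: (le_trans (entry_normM _ _)).
have t01 : 0 < t <= 1 by rewrite t0 ltW.
have u01 : 0 < 1 - t <= 1 by apply/andP; split; lra.
apply: (le_trans (ler_pM _ _ (rpow_sub1_norm_le AK _ t01) (rpow_sub1_norm_le DK _ u01))).
- exact: nm_ge0.
- exact: nm_ge0.
rewrite mulrACA -!mulrA ler_wpM2l// ler_wpM2l//.
by apply: beta_dominator_le => //; exact: ltW.
Qed.

Lemma beta_integrable {A D} : mx_stable A -> mx_stable D ->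
  entry_integrable `]0, 1[ (beta_integrand A D).
Proof.
move=> sA sD; have [g ig gle] := beta_dominated sA sD.
by apply: entry_integrable_le ig gle => //; exact: beta_measurable.
Qed.

Lemma mbeta_comm {M A D} : mx_stable A -> mx_stable D -> comm_mx M A -> comm_mx M D ->
  comm_mx M (mbeta A D).
Proof.
move=> sA sD MA MD; rewrite mbeta.unlock; apply: entry_integral_comm => //; first exact: beta_integrable.
move=> t _; apply: comm_mxM; apply: comm_rpow; apply: comm_mxB => //; exact: comm_mx1.
Qed.

Lemma exp_dominates_power (m : R) : exists2 K : R, 0 <= K &
  forall t, 1 <= t -> expR (- t) * t `^ m <= K.
Proof.
pose N := (Num.truncn `|m|).+1.
exists N`!%:R => // t t1; have t0 : 0 < t by rewrite (lt_le_trans _ t1).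
rewrite expRN mulrC ler_pdivrMr ?expR_gt0//.
apply: (@le_trans _ _ (t ^+ N)).
  rewrite -powR_mulrn ?(ltW t0)//; apply: ler_powR => //.
  by rewrite (le_trans (ler_norm m))// ltW// truncnS_gt.
have := expR_ge1Dxn (Num.truncn `|m|) (ltW t0); rewrite -/N => h.
by rewrite mulrC -ler_pdivrMr ?ltr0n ?fact_gt0//; apply: le_trans h; rewrite lerDr.
Qed.

Lemma gamma_dominated {A} : mx_stable A ->
  exists2 g : R -> R, mu.-integrable `]0, +oo[ (EFin \o g) &
    forall t, `]0, +oo[%classic t -> nm (gamma_integrand A t) <= g t.
Proof.
move=> [c [K [/andP[c0 c1] K0 AK]]].
(* for t >= 1, (1 + t^c)^2 <= 4 t^c t, so exp(-t) t^(A-1) has to be O(t^(-2)) *)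
have [K' K'0 HK'] := exp_dominates_power (nm (A - 1%:M) + 2).
pose K2 := 4 * (K + (1 + n%:R) * K').
exists (fun t => K2 * (t `^ (c - 1) * (1 + t `^ c) ^- 2)).
  by apply: integrable_scale => //; exact: gamma_dominator_integrable.
move=> t /half_lineP t0.
rewrite /gamma_integrand entry_normZ ger0_norm ?expR_ge0//.
have q0 : 0 < 1 + t `^ c by rewrite ltr_wpDr ?powR_ge0.
have nK : 0 <= (1 + n%:R) * K' by rewrite mulr_ge0// addr_ge0.
rewrite mulrA ler_pdivlMr ?exprn_gt0//.
have [t1|t1] := leP t 1.
  have tc1 : t `^ c <= 1 by apply: powR_le1; [rewrite t1 ltW|exact: ltW].
  have q4 : (1 + t `^ c) ^+ 2 <= 4.
    by have := powR_ge0 t c; move: (t `^ c) tc1 => u u1 u0; nra.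
  have := rpow_sub1_norm_le AK _ (introT andP (conj t0 t1)).
  have e1 : expR (- t) <= 1 by rewrite expR_le1 oppr_le0 ltW.
  move: (nm_ge0 (rpow t (A - 1%:M))) (expR_ge0 (- t)) (powR_ge0 t (c - 1)).
  rewrite /K2; move: (nm _) (expR _) (t `^ (c - 1)) e1 => w e p e1 w0 e0 p0 wp.
  have h1 : e * w <= K * p by nra.
  have h2 : 0 <= e * w by nra.
  have h3 : e * w * (1 + t `^ c) ^+ 2 <= K * p * 4.
    by apply: ler_pM => //; rewrite exprn_ge0// ltW.
  have : 0 <= (1 + n%:R) * K' * p by rewrite mulr_ge0.
  by move: h3; nra.
have tc : t `^ c <= t by rewrite ler1_powR// ltW.
have t1' := ltW t1.
have tc1 : 1 <= t `^ c by rewrite -(powRr0 t) ler_powR// ltW.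
have q4 : (1 + t `^ c) ^+ 2 <= 4 * (t `^ c * t).
  by move: (t `^ c) tc tc1 => u ut u1; nra.
have e1 : expR (- t) * t `^ (nm (A - 1%:M)) <= K' * (t^-1 * t^-1).
  have := HK' t t1'; rewrite powRD ?(gt_eqF t0) ?implybT// powR_mulrn ?(ltW t0)//.
  rewrite mulrA -ler_pdivlMr ?exprn_gt0// expr2 invfM.
  exact.
have h1 : expR (- t) * nm (rpow t (A - 1%:M)) <= (1 + n%:R) * K' * (t^-1 * t^-1).
  apply: (le_trans (ler_wpM2l (expR_ge0 _) (rpow_norm_ge1 _ _ t1'))).
  by rewrite mulrCA -[leRHS]mulrA ler_wpM2l// addr_ge0.
apply: (le_trans (ler_pM _ _ h1 q4)).
- by rewrite mulr_ge0 ?expR_ge0 ?nm_ge0.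
- by rewrite exprn_ge0// ltW.
rewrite powR_sub1//.
rewrite [leLHS](_ : _ = 4 * ((1 + n%:R) * K') * (t `^ c / t)); last first.
  by field; rewrite gt_eqF.
rewrite /K2 ler_wpM2r ?divr_ge0 ?powR_ge0 ?(ltW t0)//.
by rewrite ler_wpM2l// lerDr.
Qed.

Lemma gamma_measurable A : entry_measurable `]0, +oo[ (gamma_integrand A).
Proof.
apply: entry_measurableZ; last by apply: rpow_measurable => // t /half_lineP.
apply: measurableT_comp; first exact: measurable_expR.
exact: oppr_measurable.
Qed.

Lemma gamma_integrable {A} : mx_stable A -> entry_integrable `]0, +oo[ (gamma_integrand A).
Proof.
move=> sA; have [g ig gle] := gamma_dominated sA.
by apply: entry_integrable_le ig gle => //; exact: gamma_measurable.
Qed.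

Lemma mgamma_comm {M A} : mx_stable A -> comm_mx M A -> comm_mx M (mgamma A).
Proof.
move=> sA MA; rewrite mgamma.unlock; apply: entry_integral_comm => //; first exact: gamma_integrable.
move=> t _; apply: comm_mxZ; apply: comm_rpow; apply: comm_mxB => //; exact: comm_mx1.
Qed.

End BetaGamma.

(** * Recurrences of the Beta integral *)

Section BetaRecurrence.
Context {R : realType} {n : nat}.
Notation mu := (@lebesgue_measure R).
Implicit Types (A D M : 'M[R]_n).

Lemma entry_integral_primitive {f F : R -> 'M[R]_n} {L0 L1 : 'M[R]_n} :
  (forall t, 0 < t -> t < 1 -> mx_derive F t (f t)) ->
  (forall t, 0 < t -> t < 1 -> exists M, mx_derive f t M) ->
  entry_integrable `]0, 1[ f ->
  (fun k => F (left_unit k)) ~> L0 -> (fun k => F (1 - left_unit k)) ~> L1 ->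
  entry_integral `]0, 1[ f = L1 - L0.
Proof.
move=> dF df fi F0 F1; apply/matrixP => i j; rewrite !mxE.
apply: (@integral_primitive_limits _ _ left_unit (fun k => 1 - left_unit k)
   _ left_unit_dec _ unit_interval_exhaustion (fun t => f t i j) (fun t => F t i j)).
- by move=> k; case/andP: (@left_unit_itv R k).
- by move=> k l kl; rewrite lerB// left_unit_dec.
- by move=> t /unit_itvP[t0 t1]; exact: dF.
- move=> t /unit_itvP[t0 t1]; have [M fM] := df _ t0 t1.
  exact: mx_derive_continuous fM.
- exact: fi.
- exact: F0.
- exact: F1.
Qed.

Lemma rpow_left_unit_cvg0 {A} {G : nat -> 'M[R]_n} {K : R} : mx_stable A ->
  (forall k, nm (G k) <= K) -> (fun k => rpow (left_unit k) A *m G k) ~> 0.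
Proof.
move=> [c [K' [/andP[c0 c1] K'0 AK]]] GK i j; rewrite mxE.
have K0 : 0 <= K by rewrite (le_trans _ (GK 0%N))// nm_ge0.
have lim : K' * K * left_unit k `^ c @[k --> \oo] --> 0.
  rewrite -[X in _ --> X](mulr0 (K' * K)); apply: cvgM; first exact: cvg_cst.
  have /cvg_at_rightP := powR_cvg0 c0; apply; split; last exact: left_unit_cvg.
  by move=> k; case/andP: (@left_unit_itv R k).
apply: (squeeze_cvgr _ _ lim); last by rewrite -oppr0; exact: cvgN lim.
apply: nearW => k; rewrite -ler_norml.
rewrite (le_trans (entry_norm_entry _ i j))// (le_trans (entry_normM _ _))//.
rewrite [leRHS]mulrAC ler_pM ?nm_ge0// AK//.
by have /andP[? ?] := @left_unit_itv R k; apply/andP; split; lra.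
Qed.

Lemma rpow_near1_cvg A : (fun k => rpow (1 - left_unit k) A) ~> 1%:M.
Proof.
move=> i j; rewrite -(rpow1 A).
have dA := mx_derive_rpow A ltr01.
have l1 : 1 - left_unit k @[k --> \oo] --> (1 : R).
  by rewrite -[X in _ --> X]subr0; apply: cvgB; [exact: cvg_cst|exact: left_unit_cvg].
exact: (cvg_comp _ (fun s => rpow s A i j) l1 (mx_derive_continuous i j dA)).
Qed.

Lemma mx_stable_add_scalar {A} {x : R} : 0 <= x -> mx_stable A -> mx_stable (A + x%:M).
Proof.
move=> x0 sA; apply: mx_stableD => //; first by rewrite /comm_mx scalar_mxC.
exists n%:R => // t /andP[t0 t1].
rewrite rpow_scalar// -scalemx1 entry_normZ entry_norm1 ger0_norm ?powR_ge0//.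
by rewrite ler_piMl// powR_le1 ?(ltW t0).
Qed.

(** From 1 = t + (1 - t). *)
Lemma mbeta_split {A D} : mx_stable A -> mx_stable D ->
  mbeta A D = mbeta (A + 1%:M) D + mbeta A (D + 1%:M).
Proof.
move=> sA sD.
have sA1 := rpow_bounded_stable (mx_stable_bounded sA).
have sD1 := rpow_bounded_stable (mx_stable_bounded sD).
rewrite mbeta.unlock.
have [_ <-] := entry_integralD (measurable_itv _) (beta_integrable sA1 sD) (beta_integrable sA sD1).
apply: eq_entry_integral => t /unit_itvP[t0 t1]; rewrite /beta_integrand !addrK.
have u0 : 0 < 1 - t by rewrite subr_gt0.
have -> : rpow t A = t *: rpow t (A - 1%:M).
  by rewrite rpow_sub1// scalerA divff ?scale1r ?gt_eqF.
have -> : rpow (1 - t) D = (1 - t) *: rpow (1 - t) (D - 1%:M).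
  by rewrite rpow_sub1// scalerA divff ?scale1r ?gt_eqF.
by rewrite -scalemxAl -scalemxAr -scalerDl [t + _]addrC subrK scale1r.
Qed.

(** Integration by parts: the derivative of t^A (1-t)^D integrates to 0. *)
Lemma mbeta_parts {A D} : comm_mx A D -> mx_stable A -> mx_stable D ->
  A *m mbeta A (D + 1%:M) = D *m mbeta (A + 1%:M) D.
Proof.
move=> AD sA sD.
have sA1 := rpow_bounded_stable (mx_stable_bounded sA).
have sD1 := rpow_bounded_stable (mx_stable_bounded sD).
rewrite mbeta.unlock.
have [K K0 HK] := mx_stable_bounded sA; have [K' K'0 HK'] := mx_stable_bounded sD.
have [i1 E1] := entry_integral_mull A (measurable_itv _) (beta_integrable sA sD1).
have [i2 E2] := entry_integral_mull (- D) (measurable_itv _) (beta_integrable sA1 sD).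
have [i3 E3] := entry_integralD (measurable_itv _) i1 i2.
apply/eqP; rewrite -subr_eq0 -mulNmx -E1 -E2 -E3; apply/eqP.
have unit01 k : 0 < @left_unit R k <= 1 /\ 0 < 1 - @left_unit R k <= 1.
  by have /andP[? ?] := @left_unit_itv R k; split; apply/andP; split; lra.
rewrite -[RHS](subr0 0).
apply: (@entry_integral_primitive _ (fun t => rpow t A *m rpow (1 - t) D)) => //.
- move=> t t0 t1; apply: mx_derive_eq; last first.
    by apply: mx_deriveM; [exact: mx_derive_rpow|exact: mx_derive_rpow_onem].
  rewrite /beta_integrand !addrK mulmxN mulNmx -mulmxA; congr (_ - _).
  by rewrite !mulmxA (comm_rpow t (comm_mx_sym AD)).
- move=> t t0 t1.
  have [M1 d1] := mx_derive_beta_integrand A (D + 1%:M) t0 t1.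
  have [M2 d2] := mx_derive_beta_integrand (A + 1%:M) D t0 t1.
  eexists; apply: mx_deriveD; apply: mx_deriveM; try exact: mx_derive_cst.
    exact: d1.
  exact: d2.
- apply: (rpow_left_unit_cvg0 sA) => k; apply: HK'.
  by have [] := unit01 k.
- apply: (mx_cvg_eq (fun k => rpow (left_unit k) D *m rpow (1 - left_unit k) A)) => [k|].
    rewrite subKr.
    by apply/comm_mx_sym/comm_rpow/comm_mx_sym/comm_rpow.
  by apply: (rpow_left_unit_cvg0 sD) => k; apply: HK; have [] := unit01 k.
Qed.

(** The left side is D (B(A+1, D) + B(A, D+1)) after integration by parts. *)
Lemma mbeta_succr {A D} : comm_mx A D -> mx_stable A -> mx_stable D ->
  (A + D) *m mbeta A (D + 1%:M) = D *m mbeta A D.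
Proof.
move=> AD sA sD.
by rewrite mulmxDl mbeta_parts// -mulmxDr -mbeta_split.
Qed.

Lemma mbeta_succl {A D} : comm_mx A D -> mx_stable A -> mx_stable D ->
  (A + D) *m mbeta (A + 1%:M) D = A *m mbeta A D.
Proof.
move=> AD sA sD.
by rewrite mulmxDl -mbeta_parts// -mulmxDr -mbeta_split.
Qed.

Lemma mbeta1r {M} : mx_stable M -> M *m mbeta M 1%:M = 1%:M.
Proof.
move=> sM.
have s1 : mx_stable (1%:M : 'M[R]_n) by exact: mx_stable1.
rewrite mbeta.unlock.
have [i1 <-] := entry_integral_mull M (measurable_itv _) (beta_integrable sM s1).
rewrite -[RHS]subr0.
apply: (@entry_integral_primitive _ (fun t => rpow t M)) => //.
- move=> t t0 t1; apply: mx_derive_eq; last exact: mx_derive_rpow.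
  by rewrite /beta_integrand subrr rpow0 mulmx1.
- move=> t t0 t1; have [M1 d1] := mx_derive_beta_integrand M 1%:M t0 t1.
  by eexists; apply: mx_deriveM; [exact: mx_derive_cst|exact: d1].
- apply: (mx_cvg_eq (fun k => rpow (left_unit k) M *m 1%:M)) => [k|].
    by rewrite mulmx1.
  by apply: (rpow_left_unit_cvg0 sM) => k; exact: lexx.
- exact: rpow_near1_cvg.
Qed.

Definition rising A (k : nat) : 'M[R]_n := \prod_(j < k) (A + j%:R%:M).

Lemma rising0 A : rising A 0 = 1%:M.
Proof. by rewrite /rising big_ord0. Qed.

Lemma risingS A k : rising A k.+1 = rising A k *m (A + k%:R%:M).
Proof. by rewrite /rising big_ord_recr. Qed.

Lemma comm_mx_add_scalar {A M} (x : R) : comm_mx M A -> comm_mx M (A + x%:M).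
Proof. by move=> MA; apply: comm_mxD => //; rewrite /comm_mx scalar_mxC. Qed.

Lemma comm_rising {A M} k : comm_mx M A -> comm_mx M (rising A k).
Proof.
move=> MA; elim: k => [|k IH]; first by rewrite rising0; exact: comm_mx1.
by rewrite risingS; apply: comm_mxM => //; exact: comm_mx_add_scalar.
Qed.

Lemma rising_unit {A} k : mx_stable A -> rising A k \in unitmx.
Proof.
move=> sA; elim: k => [|k IH]; first by rewrite rising0 unitmx1.
by rewrite risingS unitmx_mul IH/= mx_stable_unit//; exact: mx_stable_add_scalar.
Qed.

Lemma addmx_nat0 A : A + 0%:R%:M = A.
Proof. by apply/matrixP => i j; rewrite !mxE mul0rn addr0. Qed.

Lemma addmx_natS A k : A + k.+1%:R%:M = A + k%:R%:M + 1%:M.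
Proof. by apply/matrixP => i j; rewrite !mxE -natr1 mulrnDl addrA. Qed.

Lemma mbeta_risingr {A D} k : comm_mx A D -> mx_stable A -> mx_stable D ->
  rising (A + D) k *m mbeta A (D + k%:R%:M) = rising D k *m mbeta A D.
Proof.
move=> AD sA sD; elim: k => [|k IH].
  by rewrite !rising0 addmx_nat0 !mul1mx.
have sDk := mx_stable_add_scalar (ler0n R k) sD.
have ADk := comm_mx_add_scalar k%:R AD.
rewrite !risingS (addmx_natS D) -(mulmxA (rising (A + D) k)) -(addrA A D).
rewrite (mbeta_succr ADk sA sDk).
have c : comm_mx (D + k%:R%:M) (rising (A + D) k).
  apply/comm_rising/comm_mx_sym/comm_mx_add_scalar/comm_mx_sym/comm_mxD.
    exact: comm_mx_sym.
  exact: comm_mx_refl.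
have c' : comm_mx (D + k%:R%:M) (rising D k).
  by apply/comm_rising/comm_mx_sym/comm_mx_add_scalar; exact: comm_mx_refl.
by rewrite (mulmxA (rising (A + D) k)) -c -mulmxA IH mulmxA c'.
Qed.

Lemma mbeta_risingl {A D} k : comm_mx A D -> mx_stable A -> mx_stable D ->
  rising (A + D) k *m mbeta (A + k%:R%:M) D = rising A k *m mbeta A D.
Proof.
move=> AD sA sD; elim: k => [|k IH].
  by rewrite !rising0 addmx_nat0 !mul1mx.
have sAk := mx_stable_add_scalar (ler0n R k) sA.
have ADk := comm_mx_sym (comm_mx_add_scalar k%:R (comm_mx_sym AD)).
rewrite !risingS (addmx_natS A) -(mulmxA (rising (A + D) k)) (addrAC A D).
rewrite (mbeta_succl ADk sAk sD).
have c : comm_mx (A + k%:R%:M) (rising (A + D) k).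
  by apply/comm_rising/comm_mx_sym/comm_mx_add_scalar/comm_mx_sym/comm_mxD.
have c' : comm_mx (A + k%:R%:M) (rising A k).
  by apply/comm_rising/comm_mx_sym/comm_mx_add_scalar; exact: comm_mx_refl.
by rewrite (mulmxA (rising (A + D) k)) -c -mulmxA IH mulmxA c'.
Qed.

End BetaRecurrence.

(** * Scaling of Lebesgue integrals *)

Section Scaling.
Context {R : realType}.
Notation mu := (@lebesgue_measure R).
Local Open Scope ereal_scope.

(** By uniqueness of the measure giving each interval its length. *)
Lemma lebesgue_measure_scale {c : R} {S : set R} : (0 < c)%R -> measurable S ->
  mu S = c%:E * pushforward mu ( *%R c : _ -> measurableTypeR R) S.
Proof.
move=> c0 mS.
have mphi : measurable_fun setT ( *%R c : measurableTypeR R -> measurableTypeR R).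
  exact: mulrl_measurable.
pose nu := measure_function_pushforward__canonical__measure_function_Measure mu mphi.
apply: (@lebesgue_measure_unique R (mscale (NngNum (ltW c0)) nu)) => //= _ [[a b]] _ <-.
rewrite /mscale/= /pushforward.
have -> : *%R c @^-1` `]a, b] = `](a / c)%R, (b / c)%R]%classic.
  apply/seteqP; split => x /=; rewrite !in_itv/= => /andP[ax xb]; apply/andP; split.
  - by rewrite ltr_pdivrMr// mulrC.
  - by rewrite ler_pdivlMr// mulrC.
  - by rewrite mulrC -ltr_pdivrMr.
  - by rewrite mulrC -ler_pdivlMr.
rewrite !lebesgue_measure_itv/= !lte_fin ltr_pM2r ?invr_gt0//.
case: ifP => _; last by rewrite mule0.
by rewrite -!EFinB -EFinM -mulrBl mulrCA divff ?gt_eqF// mulr1.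
Qed.

Lemma ge0_integral_scale {f : R -> \bar R} {c : R} : (0 < c)%R ->
  measurable_fun setT f -> (forall t, 0 <= f t) ->
  \int[mu]_t f t = c%:E * \int[mu]_t f (c * t)%R.
Proof.
move=> c0 mf f0.
have mphi : measurable_fun setT ( *%R c : measurableTypeR R -> measurableTypeR R).
  exact: mulrl_measurable.
pose nu := measure_function_pushforward__canonical__measure_function_Measure mu mphi.
rewrite (eq_measure_integral (mscale (NngNum (ltW c0)) nu)); last first.
  by move=> S mS _; exact: lebesgue_measure_scale.
rewrite ge0_integral_mscale//=; congr (_ * _).
by rewrite (ge0_integral_pushforward mphi).
Qed.

(** Positive and negative parts are scaled separately. *)
Lemma integral_scale {f : R -> \bar R} {c : R} : (0 < c)%R ->
  measurable_fun setT f -> mu.-integrable setT (fun t => f (c * t)%R) ->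
  \int[mu]_t f t = c%:E * \int[mu]_t f (c * t)%R.
Proof.
move=> c0 mf fi.
rewrite integralE (ge0_integral_scale c0 (measurable_funepos mf))//.
rewrite (ge0_integral_scale c0 (measurable_funeneg mf))//.
rewrite [in RHS](integralE mu setT (fun t => f (c * t)%R)) [RHS]muleBr//.
  congr (_ * _ - _ * _); apply: eq_integral => t _.
    by rewrite !funeposE.
  by rewrite !funenegE.
apply: fin_num_adde_defl; rewrite fin_numN.
exact: (@integrable_neg_fin_num _ _ _ mu setT measurableT _ fi).
Qed.

Lemma measurable_unit_scale {h : R -> R} {c : R} : (0 < c)%R ->
  measurable_fun (`]0%R, 1%R[%classic : set R) h ->
  measurable_fun (`]0%R, +oo[%classic : set R)
    (fun s => if (s < c)%R then h (s / c)%R else 0%R).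
Proof.
move=> c0 mh.
pose h0 : R -> R := h \_ (`]0%R, 1%R[%classic : set R).
have mh0 : measurable_fun setT h0.
  exact: (proj1 (measurable_restrictT _ (measurable_itv _))).
have mh1 : measurable_fun setT (fun s => h0 (c^-1 * s)%R).
  by apply: measurableT_comp mh0 _; exact: mulrl_measurable.
apply: (eq_measurable_fun (fun s => h0 (c^-1 * s)%R)).
  move=> s; rewrite inE/= in_itv/= andbT => s0.
  rewrite /h0 !patchE !mem_setE !in_itv/=.
  rewrite pmulr_rgt0 ?invr_gt0// s0 (mulrC c^-1%R) ltr_pdivrMr// mul1r.
  by case: (s < c)%R.
by apply: measurable_funTS.
Qed.

(** The substitution t = s/c, with the new integral extended to the half line so
    that [c] may tend to infinity under it. *)
Lemma Rintegral_unit_scale {h : R -> R} {c : R} : (0 < c)%R ->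
  measurable_fun (`]0%R, 1%R[%classic : set R) h ->
  mu.-integrable `]0%R, 1%R[ (EFin \o h) ->
  (\int[mu]_(t in `]0, 1[) h t =
   c^-1 * \int[mu]_(s in `]0, +oo[) (if s < c then h (s / c) else 0))%R.
Proof.
move=> c0 mh ih.
pose h0 : R -> \bar R := (EFin \o h) \_ (`]0%R, 1%R[%classic : set R).
have mh0 : measurable_fun setT h0.
  apply: (proj1 (measurable_restrictT _ (measurable_itv _))).
  exact/measurable_EFinP.
have ih0 : mu.-integrable setT h0.
  have := proj1 (@integrable_mkcond _ _ _ mu `]0%R, 1%R[ (EFin \o h) (measurable_itv _)) ih.
  by apply: eq_integrable => // t _; rewrite /h0 !patchE.
have ci : (0 < c^-1)%R by rewrite invr_gt0.
pose h1 s := h0 (c^-1 * s)%R.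
have mh1 : measurable_fun setT h1.
  by apply: measurableT_comp mh0 _; exact: mulrl_measurable.
have h1c : (fun t => h1 (c * t)%R) = h0.
  by apply/funext => t; rewrite /h1 mulrA mulVf ?mul1r ?gt_eqF.
have := integral_scale c0 mh1; rewrite h1c => /(_ ih0) E.
rewrite /Rintegral.
have -> : \int[mu]_(t in `]0%R, 1%R[) (h t)%:E = \int[mu]_t h0 t.
  by rewrite /h0 -integral_mkcond.
have -> : \int[mu]_(s in `]0%R, +oo[) (if (s < c)%R then h (s / c) else 0%R)%:E =
    \int[mu]_t h1 t.
  rewrite integral_mkcond; apply: eq_integral => s _.
  rewrite /h1 /h0 !patchE !mem_setE !in_itv/= andbT.
  rewrite pmulr_rgt0// (mulrC c^-1%R) ltr_pdivrMr// mul1r.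
  by case: (0 < s)%R => //=; case: (s < c)%R.
rewrite E fineM//.
  by rewrite /= mulrA mulVf ?mul1r ?gt_eqF.
exact: (@integrable_fin_num _ _ _ mu setT measurableT _ ih0).
Qed.

End Scaling.

(** * Gauss's limit for the Gamma integral *)

Section ExponentialLimit.
Context {R : realType}.

Lemma onem_expX_le {x : R} k : 0 <= x -> x <= 1 -> (1 - x) ^+ k <= expR (- (k%:R * x)).
Proof.
move=> x0 x1; rewrite -mulrN expRM_natl lerXn2r ?nnegrE ?expR_ge0 ?subr_ge0//.
exact: expR_ge1Dx.
Qed.

(** From 1/(1-x) = 1 + x/(1-x) <= exp(x/(1-x)). *)
Lemma onem_expX_ge {x : R} k : 0 <= x -> x < 1 ->
  expR (- (k%:R * x / (1 - x))) <= (1 - x) ^+ k.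
Proof.
move=> x0 x1; have y0 : 0 < 1 - x by rewrite subr_gt0.
rewrite -mulrA -mulrN expRM_natl lerXn2r ?nnegrE ?expR_ge0 ?(ltW y0)//.
rewrite expRN -[leRHS]invrK lef_pV2 ?posrE ?expR_gt0 ?invr_gt0//.
rewrite [leLHS](_ : _ = 1 + x / (1 - x)) ?expR_ge1Dx//.
by field; rewrite gt_eqF.
Qed.

Lemma div_succn_cvg0 (s : R) : s / k.+1%:R @[k --> \oo] --> 0.
Proof.
rewrite -[X in _ --> X](mulr0 s); apply: cvgM; first exact: cvg_cst.
exact: cvg_harmonic.
Qed.

Lemma onem_div_succn_cvg1 (s : R) : 1 - s / k.+1%:R @[k --> \oo] --> (1 : R).
Proof.
rewrite -[X in _ --> X]subr0; apply: cvgB; first exact: cvg_cst.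
exact: div_succn_cvg0.
Qed.

Lemma near_lt_succn (s : R) : \forall k \near \oo, s < k.+1%:R.
Proof.
exists (Num.truncn s) => // k /= kN.
by rewrite (lt_le_trans (truncnS_gt _))// ler_nat.
Qed.

Lemma expR_euler_limit (s : R) : 0 < s ->
  (1 - s / k.+1%:R) ^+ k.+1 @[k --> \oo] --> expR (- s).
Proof.
move=> s0.
apply: (@squeeze_cvgr _ _ _ _ (fun k : nat => expR (- (s / (1 - s / k.+1%:R))))
  (cst (expR (- s)))).
- near=> k.
  have k0 : 0 < k.+1%:R :> R by [].
  have sk : s < k.+1%:R by near: k; exact: near_lt_succn.
  have x0 : 0 <= s / k.+1%:R by rewrite divr_ge0// ltW.
  have x1 : s / k.+1%:R < 1 by rewrite ltr_pdivrMr// mul1r.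
  have kx : k.+1%:R * (s / k.+1%:R) = s by rewrite mulrCA divff ?mulr1// gt_eqF.
  have := onem_expX_ge k.+1 x0 x1; rewrite kx => ->.
  by have := onem_expX_le k.+1 x0 (ltW x1); rewrite kx.
- apply: continuous_cvg; first exact: continuous_expR.
  apply: cvgN; rewrite -[X in _ --> X](mulr1 s) -[X in _ --> s * X]invr1.
  apply: cvgM; first exact: cvg_cst.
  by apply: cvgV; [exact: oner_neq0|exact: onem_div_succn_cvg1].
- exact: cvg_cst.
Unshelve. all: by end_near. Qed.

End ExponentialLimit.

Section GaussLimit.
Context {R : realType} {n : nat}.
Notation mu := (@lebesgue_measure R).
Implicit Types (A D M : 'M[R]_n).

(** What t^(A-1) (1-t)^(D+N) becomes under t = s/N, with N = k+1, when
    multiplied by N^(A-1). *)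
Definition gauss_integrand A D (k : nat) (s : R) : 'M[R]_n :=
  if s < k.+1%:R
  then (1 - s / k.+1%:R) ^+ k.+1 *: (rpow s (A - 1%:M) *m rpow (1 - s / k.+1%:R) D)
  else 0.

Lemma gauss_integrandE A D k (s : R) : 0 < s -> s < k.+1%:R ->
  gauss_integrand A D k s = rpow k.+1%:R (A - 1%:M) *m
    beta_integrand A (D + 1%:M + k.+1%:R%:M) (s / k.+1%:R).
Proof.
move=> s0 sk; have k0 : 0 < k.+1%:R :> R by [].
rewrite /gauss_integrand sk /beta_integrand mulmxA -rpowMl ?divr_gt0//.
rewrite mulrCA divff ?gt_eqF// mulr1 [D + _ + _]addrAC addrK.
by rewrite rpow_add_nat ?scalemxAr// subr_gt0 ltr_pdivrMr// mul1r.
Qed.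

Lemma gauss_integrand_entry A D k i j :
  let h t := (rpow k.+1%:R (A - 1%:M) *m beta_integrand A (D + 1%:M + k.+1%:R%:M) t) i j in
  forall s, 0 < s ->
  gauss_integrand A D k s i j = if s < k.+1%:R then h (s / k.+1%:R) else 0.
Proof.
move=> h s s0; case: ifPn => sk; first by rewrite gauss_integrandE.
by rewrite /gauss_integrand (negPf sk) mxE.
Qed.

Lemma gauss_measurable A D k : entry_measurable `]0, +oo[ (gauss_integrand A D k).
Proof.
move=> i j.
pose h t := (rpow k.+1%:R (A - 1%:M) *m beta_integrand A (D + 1%:M + k.+1%:R%:M) t) i j.
have mh : measurable_fun (`]0, 1[%classic : set R) h.
  exact: (entry_measurableM (entry_measurable_cst _ _) (beta_measurable _ _) i j).
apply: (eq_measurable_fun (fun s : R => (if s < k.+1%:R then h (s / k.+1%:R) else 0) : R)).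
  by move=> s /[!inE] /half_lineP s0; rewrite gauss_integrand_entry.
exact: measurable_unit_scale.
Qed.

Lemma gauss_integral A D k : mx_stable A -> mx_stable (D + 1%:M) ->
  entry_integral `]0, +oo[ (gauss_integrand A D k) =
  rpow k.+1%:R A *m mbeta A (D + 1%:M + k.+1%:R%:M).
Proof.
move=> sA sD; have k0 : 0 < k.+1%:R :> R by [].
have sDk : mx_stable (D + 1%:M + k.+1%:R%:M) by exact: mx_stable_add_scalar.
have [ih Eh] := entry_integral_mull (rpow k.+1%:R (A - 1%:M)) (measurable_itv _)
  (beta_integrable sA sDk).
have -> : rpow k.+1%:R A = k.+1%:R *: rpow k.+1%:R (A - 1%:M).
  by rewrite rpow_sub1// scalerA divff ?scale1r// gt_eqF.
rewrite -scalemxAl mbeta.unlock -Eh; apply/matrixP => i j; rewrite !mxE.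
have mh := entry_measurableM (entry_measurable_cst _ (rpow k.+1%:R (A - 1%:M)))
  (beta_measurable A (D + 1%:M + k.+1%:R%:M)) i j.
rewrite (Rintegral_unit_scale k0 mh (ih i j)) mulrA divff ?gt_eqF// mul1r.
apply: eq_Rintegral => s /[!inE] /half_lineP s0.
by rewrite gauss_integrand_entry.
Qed.

(** From (1 - s/N)^N <= exp(-s): the bound does not depend on [k]. *)
Lemma gauss_norm_le {A D k} {K s : R} : 0 <= K ->
  (forall t, 0 < t <= 1 -> nm (rpow t D) <= K) -> 0 < s ->
  nm (gauss_integrand A D k s) <= K * nm (gamma_integrand A s).
Proof.
move=> K0 DK s0; rewrite /gauss_integrand; case: ifPn => [sk|_]; last first.
  by rewrite entry_norm0 mulr_ge0 ?nm_ge0.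
have k0 : 0 < k.+1%:R :> R by [].
have x1 : s / k.+1%:R < 1 by rewrite ltr_pdivrMr// mul1r.
have x0 : 0 < s / k.+1%:R by rewrite divr_gt0.
rewrite /gamma_integrand !entry_normZ (ger0_norm (expR_ge0 _)) mulrCA.
rewrite ger0_norm ?exprn_ge0 ?subr_ge0 ?(ltW x1)//.
apply: ler_pM; rewrite ?exprn_ge0 ?subr_ge0 ?(ltW x1) ?nm_ge0//.
  have := onem_expX_le k.+1 (ltW x0) (ltW x1).
  by rewrite mulrCA divff ?mulr1// gt_eqF.
rewrite (le_trans (entry_normM _ _))// mulrC ler_wpM2r ?nm_ge0// DK//.
by rewrite subr_gt0 x1 lerBlDr lerDl ltW.
Qed.

Lemma gauss_integrand_cvg A D (s : R) : 0 < s ->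
  (fun k => gauss_integrand A D k s) ~> gamma_integrand A s.
Proof.
move=> s0.
have lim : (fun k => (1 - s / k.+1%:R) ^+ k.+1 *:
    (rpow s (A - 1%:M) *m rpow (1 - s / k.+1%:R) D)) ~> gamma_integrand A s.
  rewrite /gamma_integrand -[X in _ *: X]mulmx1.
  apply: mx_cvgZ; first exact: expR_euler_limit.
  apply: mx_cvgM; first exact: mx_cvg_cst.
  move=> i j; rewrite -(rpow1 D).
  have dD := mx_derive_rpow D ltr01.
  exact: (cvg_comp _ (fun u => rpow u D i j) (onem_div_succn_cvg1 s)
    (mx_derive_continuous i j dD)).
move=> i j; apply: cvg_trans (lim i j); apply: near_eq_cvg.
near=> k; rewrite /gauss_integrand ifT//; near: k; exact: near_lt_succn.
Unshelve. all: by end_near. Qed.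

(** After the substitution t = s/N the integrand is dominated by a multiple of
    that of Gamma(A), and tends to it since (1 - s/N)^N tends to exp(-s). *)
Lemma gauss_limit {A D} : mx_stable A -> rpow_bounded D ->
  (fun k => rpow k.+1%:R A *m mbeta A (D + 1%:M + k.+1%:R%:M)) ~> mgamma A.
Proof.
move=> sA bD; have sD := rpow_bounded_stable bD.
have [K K0 DK] := bD; have [g ig gle] := gamma_dominated sA.
apply: (mx_cvg_eq (fun k => entry_integral `]0, +oo[ (gauss_integrand A D k))).
  by move=> k; rewrite gauss_integral.
rewrite mgamma.unlock.
apply: (proj2 (@entry_dominated_cvg _ _ _ _ _ (fun s => K * g s) _ _ _ _ _ _)) => //.
- by move=> k; exact: gauss_measurable.
- exact: gamma_measurable.
- exact: integrable_scale.
- move=> s k s0; apply: (le_trans (gauss_norm_le K0 DK (half_lineP s0))).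
  by rewrite ler_wpM2l// gle.
- by move=> s /half_lineP s0; exact: gauss_integrand_cvg.
Qed.

End GaussLimit.

(** * Euler's products, and Beta in terms of Gamma *)

Section EulerLimit.
Context {R : realType} {n : nat}.
Implicit Types (A D M : 'M[R]_n).

Lemma comm_invmx {A B : 'M[R]_n} : comm_mx A B -> comm_mx A (invmx B).
Proof.
move=> AB; have [Bu|Bu] := boolP (B \in unitmx); last by rewrite invmx_out.
rewrite /comm_mx -[LHS]mul1mx -(mulVmx Bu) -!mulmxA; congr (_ *m _).
by rewrite mulmxA -AB -mulmxA mulmxV// mulmx1.
Qed.

Lemma rising1 k : rising (1%:M : 'M[R]_n) k = (k`!%:R)%:M.
Proof.
elim: k => [|k IH]; first by rewrite rising0.
by rewrite risingS IH -raddfD/= -scalar_mxM factS natrM mulrC -natr1 addrC.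
Qed.

(** Euler's products N! N^M ((M+1)...(M+N))^(-1), with N = k+1. *)
Definition euler_term M (k : nat) : 'M[R]_n :=
  (k.+1)`!%:R *: (rpow k.+1%:R M *m invmx (rising (M + 1%:M) k.+1)).

Lemma mbeta1_rising M k : mx_stable M ->
  mbeta M (1%:M + k%:R%:M) *m M = k`!%:R *: invmx (rising (M + 1%:M) k).
Proof.
move=> sM; have s1 : mx_stable (1%:M : 'M[R]_n) by exact: mx_stable1.
have cM1 : comm_mx M 1%:M by exact: comm_mx1.
have sM1 := rpow_bounded_stable (mx_stable_bounded sM).
have cB : comm_mx M (mbeta M 1%:M) by apply: mbeta_comm => //; exact: comm_mx_refl.
have E := mbeta_risingr k cM1 sM s1.
rewrite -[mbeta M (1%:M + _)](mulKmx (rising_unit k sM1)) E rising1.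
have cB' : mbeta M 1%:M *m M = 1%:M by rewrite -[LHS]cB mbeta1r.
by rewrite mul_scalar_mx -scalemxAr -scalemxAl -(mulmxA _ _ M) cB' mulmx1.
Qed.

(** The case D = 0 of Gauss's limit, where B(M, 1+N) M = N! (M+1)_N^(-1). *)
Lemma euler_limit {M} : mx_stable M -> euler_term M ~> mgamma M *m M.
Proof.
move=> sM.
have lim := mx_cvgM (gauss_limit sM rpow_bounded0) (mx_cvg_cst M).
apply: mx_cvg_eq lim => k.
by rewrite add0r -mulmxA mbeta1_rising// -scalemxAr.
Qed.

(** B(A, D+1+N) = (A+D+1)_N^(-1) (D+1)_N B(A, D+1), and (D+1)_N cancels against
    the denominator of [euler_term D]. *)
Lemma gauss_euler_term {A D} k : comm_mx A D -> mx_stable A -> mx_stable D ->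
  rpow k.+1%:R A *m mbeta A (D + 1%:M + k.+1%:R%:M) *m euler_term D k =
  euler_term (A + D) k *m mbeta A (D + 1%:M).
Proof.
move=> AD sA sD; set N := k.+1.
have sD1 := rpow_bounded_stable (mx_stable_bounded sD).
have sAD1 : mx_stable (A + D + 1%:M).
  apply/rpow_bounded_stable/mx_stable_bounded.
  by apply: mx_stableD => //; exact: mx_stable_bounded.
have cD1 : comm_mx A (D + 1%:M) by exact: comm_mx_add_scalar.
have DD1 : comm_mx D (D + 1%:M) by apply: comm_mx_add_scalar; exact: comm_mx_refl.
have DAD1 : comm_mx D (A + D + 1%:M).
  apply/comm_mx_add_scalar/comm_mxD; first exact: comm_mx_sym.
  exact: comm_mx_refl.
have E : mbeta A (D + 1%:M + N%:R%:M) =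
    invmx (rising (A + D + 1%:M) N) *m (rising (D + 1%:M) N *m mbeta A (D + 1%:M)).
  rewrite -(mbeta_risingr N cD1 sA sD1) addrA mulKmx//.
  exact: rising_unit.
rewrite E /euler_term (rpowD _ AD) -!scalemxAr -scalemxAl; congr (_ *: _).
set rA := rpow _ A; set rD := rpow _ D; set I := invmx (rising (A + D + _) _).
set P := rising (D + _) _; set b := mbeta _ _.
have uP : P \in unitmx by exact: rising_unit.
have brD : comm_mx b rD.
  by apply/comm_rpow/comm_mx_sym/mbeta_comm => //; exact: comm_mx_sym.
have bP : comm_mx b (invmx P).
  by apply/comm_invmx/comm_rising/comm_mx_sym/mbeta_comm.
have PrD : comm_mx P rD by apply/comm_rpow/comm_mx_sym/comm_rising.
have IrD : comm_mx I rD by apply/comm_rpow/comm_mx_sym/comm_invmx/comm_rising.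
rewrite !mulmxA -(mulmxA _ b rD) brD mulmxA -(mulmxA _ P rD) PrD mulmxA.
rewrite -(mulmxA _ I rD) IrD -!mulmxA bP; do 3! congr (_ *m _).
by rewrite mulKVmx.
Qed.

(** Taking limits in [gauss_euler_term] gives
    Gamma(A) Gamma(D) D = Gamma(A+D) (A+D) B(A, D+1) = Gamma(A+D) D B(A, D),
    and D is invertible. *)
Theorem mbeta_mgamma {A D} : comm_mx A D -> mx_stable A -> mx_stable D ->
  mgamma (A + D) *m mbeta A D = mgamma A *m mgamma D.
Proof.
move=> AD sA sD.
have sAD : mx_stable (A + D) by apply: mx_stableD => //; exact: mx_stable_bounded.
have uD := mx_stable_unit sD.
have lim1 := mx_cvgM (gauss_limit sA (mx_stable_bounded sD)) (euler_limit sD).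
have lim2 := mx_cvgM (euler_limit sAD) (mx_cvg_cst (mbeta A (D + 1%:M))).
have lim2' := mx_cvg_eq _ (fun k => gauss_euler_term k AD sA sD) lim2.
have := mx_cvg_unique lim1 lim2'.
rewrite -(mulmxA _ (A + D)) mbeta_succr//.
have -> : D *m mbeta A D = mbeta A D *m D.
  by apply: mbeta_comm.
rewrite (mulmxA (mgamma A)) (mulmxA (mgamma (A + D))) => E.
by rewrite -[LHS](mulmxK uD) -E mulmxK.
Qed.

End EulerLimit.

(** * Invertibility of the Gamma integral *)

Section GammaInvertible.
Context {R : realType} {n : nat}.
Implicit Types (M : 'M[R]_n).

(** At x = 1/(k+2), the ratio of consecutive inverse Euler products. *)
Let factor M (x : R) : 'M[R]_n := (1%:M + x *: M) *m rpow (1 - x) M.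

Let mx_derive_factor M (x : R) : x < 1 ->
  mx_derive (factor M) x (- x *: (M *m (1%:M + M) *m rpow (1 - x) (M - 1%:M))).
Proof.
move=> x1; apply: mx_derive_eq; last first.
  apply: mx_deriveM; last exact: mx_derive_rpow_onem.
  apply: mx_deriveD; first exact: mx_derive_cst.
  by apply: mx_deriveZ; exact: mx_derive_cst.
have -> : rpow (1 - x) M = (1 - x) *: rpow (1 - x) (M - 1%:M).
  by rewrite rpow_sub1 ?subr_gt0// scalerA divff ?scale1r// subr_eq0 gt_eqF.
rewrite add0r scaler0 addr0 scale1r mulmxN mulmxA -scalemxAr scalemxAl -mulmxBl.
rewrite scalemxAl; congr (_ *m _).
rewrite mulmxDr mulmx1 mulmxDl mul1mx -scalemxAl scalerBl scale1r scalerDr.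
by rewrite !scaleNr opprD addrACA subrr add0r.
Qed.

(** The derivative of [factor M] is O(x), so the mean value theorem, applied to
    each entry, bounds its distance to the identity by O(x^2). *)
Let factor_le M : mx_stable M -> exists2 C : R, 0 <= C &
  forall x, 0 <= x <= 2^-1 -> nm (factor M x - 1%:M) <= C * x ^+ 2.
Proof.
move=> [c [K [/andP[c0 _] K0 MK]]].
pose C1 := nm (M *m (1%:M + M)) * (K * 2).
have C10 : 0 <= C1 by rewrite mulr_ge0 ?nm_ge0// mulr_ge0.
exists (n%:R ^+ 2 * C1); first by rewrite mulr_ge0// exprn_ge0.
move=> x /andP[x0 x2]; rewrite -mulrA; apply: entry_norm_le => i j.
have f0 : factor M 0 = 1%:M by rewrite /factor scale0r addr0 subr0 rpow1 mulmx1.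
have -> : (factor M x - 1%:M) i j = factor M x i j - factor M 0 i j.
  by rewrite mxE [X in _ + X]mxE f0.
pose df (y : R) : R := (- y *: (M *m (1%:M + M) *m rpow (1 - y) (M - 1%:M))) i j.
have dF (y : R) : y < 1 -> is_derive y (1 : R) (fun y => factor M y i j) (df y).
  by move=> y1; exact: mx_derive_factor.
have [||y yx] := @MVT_segment R (fun y => factor M y i j) df 0 x x0.
- by move=> y /[!in_itv]/= /andP[y0 yx]; apply: dF; lra.
- apply: derivable_within_continuous => y /[!in_itv]/= /andP[y0 yx].
  have y1 : y < 1 by lra.
  by have [] := dF y y1.
move=> ->; rewrite subr0 normrM (ger0_norm x0) expr2 mulrA ler_wpM2r//.
move: yx; rewrite in_itv/= => /andP[y0 yx].
rewrite (le_trans (entry_norm_entry _ i j))// entry_normZ normrN (ger0_norm y0).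
rewrite mulrC; apply: ler_pM => //; first exact: nm_ge0.
rewrite (le_trans (entry_normM _ _))// ler_wpM2l ?nm_ge0//.
have u01 : 0 < 1 - y <= 1 by apply/andP; split; lra.
rewrite (le_trans (rpow_sub1_norm_le MK _ u01))// ler_wpM2l//.
by apply: powR_sub1_half; [apply/andP; split; lra|exact: ltW].
Qed.

Let inv_euler_term M (k : nat) : 'M[R]_n :=
  (k.+1)`!%:R^-1 *: (rising (M + 1%:M) k.+1 *m rpow k.+1%:R (- M)).

Let euler_termK M k : mx_stable M -> euler_term M k *m inv_euler_term M k = 1%:M.
Proof.
move=> sM; rewrite /euler_term /inv_euler_term -scalemxAl -scalemxAr scalerA.
rewrite divff ?scale1r ?pnatr_eq0 -?lt0n ?fact_gt0//.
rewrite mulmxA -(mulmxA (rpow _ M)) mulVmx ?mulmx1 ?rpow_mulN//.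
exact/rising_unit/rpow_bounded_stable/mx_stable_bounded.
Qed.

Let inv_euler_termS M k :
  inv_euler_term M k.+1 = inv_euler_term M k *m factor M k.+2%:R^-1.
Proof.
have k1 : 0 < k.+1%:R :> R by [].
have k2 : 0 < k.+2%:R :> R by [].
rewrite /inv_euler_term /factor.
have -> : 1 - k.+2%:R^-1 = k.+1%:R * k.+2%:R^-1 :> R.
  have e : k.+2%:R = k.+1%:R + 1 :> R by rewrite natr1.
  move: k2; rewrite e; move: (k.+1%:R : R) => u u0; field.
  by rewrite gt_eqF.
rewrite rpowMl ?invr_gt0//.
have -> : rpow k.+2%:R^-1 M = rpow k.+2%:R (- M).
  by rewrite /rpow lnV ?posrE// scaleNr scalerN.
have cN : comm_mx (rpow k.+1%:R (- M)) (1%:M + k.+2%:R^-1 *: M).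
  apply/comm_mx_sym/comm_rpow/comm_mx_sym; rewrite addrC.
  apply: comm_mxD; last exact: comm_mx1.
  apply: comm_mxZ; rewrite -scaleN1r; apply/comm_mx_sym/comm_mxZ; exact: comm_mx_refl.
have rN : rpow k.+1%:R (- M) *m rpow k.+1%:R M = 1%:M.
  by have := rpow_mulN (- M) k.+1%:R; rewrite opprK.
rewrite (risingS (M + 1%:M) k.+1).
have -> : M + 1%:M + k.+1%:R%:M = k.+2%:R *: (1%:M + k.+2%:R^-1 *: M).
  rewrite scalerDr scalerA divff ?gt_eqF// scale1r scalemx1.
  by apply/matrixP => i j; rewrite !mxE -[k.+2%:R]natr1 mulrnDl -addrA addrC [1 *+ _ + _]addrC.
rewrite -(scalemxAl k.+1`!%:R^-1) -(mulmxA (rising _ _) (rpow _ _)).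
rewrite (mulmxA (rpow k.+1%:R (- M)) (1%:M + _)) cN -(mulmxA (1%:M + _)).
rewrite (mulmxA (rpow k.+1%:R (- M))) rN mul1mx (mulmxA (rising _ _) (1%:M + _)).
rewrite -(scalemxAr k.+2%:R) -(scalemxAl k.+2%:R) scalerA; congr (_ *: _).
by rewrite [in LHS]factS natrM invfM mulrAC mulVf ?mul1r// gt_eqF.
Qed.

(** The errors C/(k+2)^2 are compared with the telescoping differences
    C (1/(k+1) - 1/(k+2)). *)
Let inv_euler_term_bounded M : mx_stable M ->
  exists K : R, forall k, nm (inv_euler_term M k) <= K.
Proof.
move=> sM; have [C C0 fC] := factor_le _ sM.
pose K := nm (inv_euler_term M 0).
have H k : nm (inv_euler_term M k) <= K * expR (C * (1 - k.+1%:R^-1)).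
  elim: k => [|k IH]; first by rewrite invr1 subrr mulr0 expR0 mulr1.
  have k1 : 0 < k.+1%:R :> R by [].
  have k2 : 0 < k.+2%:R :> R by [].
  pose y : R := k.+2%:R^-1; pose x : R := k.+1%:R^-1.
  have y2 : 0 <= y <= 2^-1.
    by rewrite invr_ge0 ler0n/= /y lef_pV2 ?posrE// ler_nat.
  have step : nm (inv_euler_term M k.+1) <= nm (inv_euler_term M k) * expR (C * (x - y)).
    rewrite inv_euler_termS -/y -[factor M y](subrK 1%:M) mulmxDr mulmx1.
    apply: (le_trans (entry_normD _ _)).
    apply: (@le_trans _ _ (nm (inv_euler_term M k) * (C * y ^+ 2 + 1))).
      rewrite mulrDr mulr1 lerD2r (le_trans (entry_normM _ _))//.
      by rewrite ler_wpM2l ?nm_ge0// fC.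
    rewrite ler_wpM2l ?nm_ge0// addrC (le_trans _ (expR_ge1Dx _))// lerD2l ler_wpM2l//.
    have -> : x - y = x * y.
      have e : k.+2%:R = k.+1%:R + 1 :> R by rewrite natr1.
      move: k1 k2; rewrite /x /y e; move: (k.+1%:R : R) => u u0 u1; field.
      by rewrite !gt_eqF.
    by rewrite expr2 ler_wpM2r ?invr_ge0// lef_pV2 ?posrE// ler_nat.
  apply: (le_trans step); apply: (le_trans (ler_wpM2r (expR_ge0 _) IH)).
  by rewrite -mulrA -expRD -mulrDr addrA subrK.
exists (K * expR C) => k; apply: (le_trans (H k)).
by rewrite ler_wpM2l ?nm_ge0// ler_expR ler_piMr// lerBlDr lerDl.
Qed.

(** Gamma(M) M is the limit of Euler's products, whose inverses stay bounded;
    such a limit annihilates no nonzero W. *)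
Theorem mgamma_unit {M} : mx_stable M -> mgamma M \in unitmx.
Proof.
move=> sM; have [K UK] := inv_euler_term_bounded _ sM.
suff : mgamma M *m M \in unitmx by rewrite unitmx_mul => /andP[].
apply: unitmx_kernel => W WG.
have := mx_cvg_norm (mx_cvgM (mx_cvg_cst W) (euler_limit sM)).
rewrite WG entry_norm0 => lim.
have limK : nm (W *m euler_term M k) * K @[k --> \oo] --> 0.
  by rewrite -[X in _ --> X](mul0r K); apply: cvgM => //; exact: cvg_cst.
apply: entry_norm_eq0; rewrite -(cvg_lim (@Rhausdorff R) limK).
apply: limr_ge; first by apply: cvgP limK.
apply: nearW => k.
rewrite -{1}[W]mulmx1 -(euler_termK _ k sM) mulmxA (le_trans (entry_normM _ _))//.
by rewrite ler_wpM2l ?nm_ge0.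
Qed.

End GammaInvertible.

(** * Termwise integration against the Beta kernel *)

Section BetaSeries.
Context {R : realType} {n : nat}.
Notation mu := (@lebesgue_measure R).
Implicit Types (A B C D M Z : 'M[R]_n) (T : nat -> 'M[R]_n).

Lemma mbeta_mgammaE {A D} : comm_mx A D -> mx_stable A -> mx_stable D ->
  mbeta A D = mgamma A *m mgamma D *m invmx (mgamma (A + D)).
Proof.
move=> AD sA sD.
have sAD : mx_stable (A + D) by apply: mx_stableD => //; exact: mx_stable_bounded.
have uG := mgamma_unit sAD.
have cG : comm_mx (mgamma (A + D)) (mbeta A D).
  have cA : comm_mx A (mgamma (A + D)).
    by apply: mgamma_comm => //; apply: comm_mxD => //; exact: comm_mx_refl.
  have cD : comm_mx D (mgamma (A + D)).
    by apply: mgamma_comm => //; apply: comm_mxD; [exact: comm_mx_sym|exact: comm_mx_refl].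
  by apply: mbeta_comm => //; exact: comm_mx_sym.
by rewrite -mbeta_mgamma// cG mulmxK.
Qed.

Lemma mbeta_unit {A D} : comm_mx A D -> mx_stable A -> mx_stable D -> mbeta A D \in unitmx.
Proof.
move=> AD sA sD; rewrite mbeta_mgammaE// !unitmx_mul unitmx_inv !mgamma_unit//.
by apply: mx_stableD => //; exact: mx_stable_bounded.
Qed.

Lemma beta_integrand_nat A D k (t : R) : 0 < t ->
  beta_integrand (A + k%:R%:M) D t = t ^+ k *: beta_integrand A D t.
Proof.
by move=> t0; rewrite /beta_integrand addrAC rpow_add_nat// -scalemxAl.
Qed.

(** Dominated convergence for the partial sums, which are bounded by the sum of
    the norms of the coefficients since 0 < t < 1; the convergence of the series
    of integrals is part of its conclusion. *)
Theorem beta_series {A D T} {S : R -> 'M[R]_n} :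
  comm_mx A D -> mx_stable A -> mx_stable D -> mx_summable T ->
  (forall t, 0 < t -> t < 1 -> (fun m => \sum_(k < m) t ^+ k *: T k) ~> S t) ->
  exists X : 'M[R]_n, [/\
    (fun m => \sum_(k < m) rising A k *m invmx (rising (A + D) k) *m T k) ~> X,
    entry_integrable `]0, 1[ (fun t => beta_integrand A D t *m S t) &
    entry_integral `]0, 1[ (fun t => beta_integrand A D t *m S t) =
      mgamma A *m mgamma D *m invmx (mgamma (A + D)) *m X].
Proof.
move=> AD sA sD sT TS.
pose F_ m t := \sum_(k < m) beta_integrand (A + k%:R%:M) D t *m T k.
have F_E m t : 0 < t -> F_ m t = beta_integrand A D t *m (\sum_(k < m) t ^+ k *: T k).
  move=> t0; rewrite mulmx_sumr; apply: eq_bigr => k _.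
  by rewrite beta_integrand_nat// -scalemxAl scalemxAr.
have sAk k : mx_stable (A + k%:R%:M) by exact: mx_stable_add_scalar.
have iT k := entry_integral_mulr (T k) (measurable_itv _) (beta_integrable (sAk k) sD).
have mF_ m : entry_measurable `]0, 1[ (F_ m).
  apply: (@entry_measurable_sum _ _ _ m
    (fun k t => beta_integrand (A + k%:R%:M) D t *m T k)) => k.
  apply: entry_measurableM; first exact: beta_measurable.
  exact: entry_measurable_cst.
have [g ig gle] := beta_dominated sA sD.
pose s := limn (series (fun k => nm (T k))).
have F_S t : `]0, 1[%classic t -> F_ ^~ t ~> beta_integrand A D t *m S t.
  move=> /unit_itvP[t0 t1].
  have lim := mx_cvgM (mx_cvg_cst (beta_integrand A D t)) (TS t t0 t1).
  by apply: mx_cvg_eq lim => m; rewrite F_E.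
have F_le t m : `]0, 1[%classic t -> nm (F_ m t) <= s * g t.
  move=> t01; have [t0 t1] := unit_itvP t01.
  rewrite F_E// (le_trans (entry_normM _ _))// mulrC.
  apply: ler_pM; rewrite ?nm_ge0 ?gle//.
  apply: (@mx_sum_partial_le _ _ (fun k => t ^+ k *: T k) _ m sT) => k.
  rewrite entry_normZ ger0_norm ?exprn_ge0 ?(ltW t0)// ler_piMl ?nm_ge0//.
  by rewrite exprn_ile1// ltW.
have mF : entry_measurable `]0, 1[ (fun t => beta_integrand A D t *m S t).
  move=> i j; apply: (@measurable_fun_cvg _ _ R _ (fun (m : nat) (t : R) => F_ m t i j)).
  - by move=> m; exact: mF_.
  - by move=> t t01; exact: F_S.
have [iF lim] := entry_dominated_cvg (measurable_itv _) mF_ mF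
  (integrable_scale s (measurable_itv _) ig) F_le F_S.
set I := entry_integral _ _ in lim.
have ub := mbeta_unit AD sA sD.
have E m : \sum_(k < m) rising A k *m invmx (rising (A + D) k) *m T k =
    invmx (mbeta A D) *m entry_integral `]0, 1[ (F_ m).
  have -> : entry_integral `]0, 1[ (F_ m) = \sum_(k < m)
      entry_integral `]0, 1[ (fun t => beta_integrand (A + k%:R%:M) D t *m T k).
    exact: (@entry_integral_sum _ _ _ m (fun k t => beta_integrand (A + k%:R%:M) D t *m T k)
      (measurable_itv _) (fun k => (iT k).1)).
  rewrite mulmx_sumr; apply: eq_bigr => k _; rewrite (iT k).2.
  have sAD : mx_stable (A + D) by apply: mx_stableD => //; exact: mx_stable_bounded.
  have uR := rising_unit k sAD.
  have cAD : comm_mx A (A + D) by apply: comm_mxD => //; exact: comm_mx_refl.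
  have cR : comm_mx (invmx (rising (A + D) k)) (rising A k).
    by apply/comm_rising/comm_mx_sym/comm_invmx/comm_rising.
  have cb : comm_mx (rising A k) (mbeta A D).
    apply: mbeta_comm => //; apply/comm_mx_sym/comm_rising; first exact: comm_mx_refl.
    exact: comm_mx_sym.
  have cI : comm_mx (invmx (rising (A + D) k)) (mbeta A D).
    apply: mbeta_comm => //; apply/comm_mx_sym/comm_invmx/comm_rising => //.
    by apply: comm_mxD; [exact: comm_mx_sym|exact: comm_mx_refl].
  have -> : entry_integral `]0, 1[ (beta_integrand (A + k%:R%:M) D) =
      invmx (rising (A + D) k) *m (rising A k *m mbeta A D).
    by rewrite -mbeta_risingl// mulKmx// mbeta.unlock.
  by rewrite cb (mulmxA (invmx (rising _ _))) cI -(mulmxA (mbeta A D)) cR -(mulmxA (mbeta A D)) mulKmx.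
exists (invmx (mbeta A D) *m I); split => //.
  exact: (mx_cvg_eq _ E (mx_cvgM (mx_cvg_cst _) lim)).
by rewrite -mbeta_mgammaE// mulKVmx.
Qed.

Lemma geometric_summable T (k0 : nat) :
  (forall k, (k0 <= k)%N -> nm (T k.+1) <= 2^-1 * nm (T k)) -> mx_summable T.
Proof.
move=> Tk.
(* large enough for the geometric bound to hold up to k0 *)
pose c := \sum_(j < k0.+1) 2 ^+ j * nm (T j).
have Tle k : nm (T k) <= c * 2^-1 ^+ k.
  have small j : (j <= k0)%N -> nm (T j) <= c * 2^-1 ^+ j.
    move=> jk; rewrite exprVn ler_pdivlMr ?exprn_gt0// mulrC.
    have jk' : (j < k0.+1)%N by rewrite ltnS.
    rewrite /c (bigD1 (Ordinal jk'))//= lerDl; apply: sumr_ge0 => i _.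
    by rewrite mulr_ge0 ?exprn_ge0 ?nm_ge0.
  have [|/ltnW kk] := leqP k k0; first exact: small.
  rewrite -(subnKC kk); elim: (k - k0)%N => [|m IH]; first by rewrite addn0; exact: small.
  rewrite addnS (le_trans (Tk _ (leq_addr _ _)))// exprS mulrCA ler_wpM2l//.
apply: (mx_summable_le _ Tle).
have := @is_cvg_geometric_series R c 2^-1; apply.
by rewrite ger0_norm ?invr_ge0// invf_lt1// ltr1n.
Qed.

(** The inverse X of B + k satisfies k X = 1 - B X, where the last term is at most
    half of the left side. *)
Lemma invmx_add_nat_norm_le B k : B + k%:R%:M \in unitmx -> 2 * nm B < k%:R ->
  nm (invmx (B + k%:R%:M)) * k%:R <= 2 * n%:R.
Proof.
move=> uB kB; set X := invmx _.
have XE : k%:R *: X = 1%:M - B *m X.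
  by rewrite -(mulmxV uB) mulmxDl addrAC subrr add0r mul_scalar_mx.
have : k%:R * nm X <= n%:R + nm B * nm X.
  rewrite -[leLHS](_ : nm (k%:R *: X) = _); last by rewrite entry_normZ normr_nat.
  rewrite XE (le_trans (entry_normB _ _))// entry_norm1 lerD2l.
  exact: entry_normM.
move: (nm_ge0 X) (nm_ge0 B); move: (nm X) (nm B) kB => x b; nra.
Qed.

(** A + k is O(k) and the two inverses are O(1/k), so the ratio of consecutive
    terms tends to 0. *)
Lemma hypergeometric_summable Z A B C T :
  (forall k, B + k%:R%:M \in unitmx) -> (forall k, C + k%:R%:M \in unitmx) ->
  (forall k, T k.+1 = T k *m (k.+1%:R^-1 *:
     (Z *m (A + k%:R%:M) *m invmx (B + k%:R%:M) *m invmx (C + k%:R%:M)))) ->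
  mx_summable T.
Proof.
move=> uB uC TS.
pose c := nm Z * (nm A + n%:R) * (2 * n%:R) * (2 * n%:R).
pose k0 := (Num.truncn (2 * (nm B + nm C + c) + 1)).+1.
apply: (@geometric_summable _ k0) => k kk.
have kR : 2 * (nm B + nm C + c) + 1 < k%:R.
  by rewrite (lt_le_trans (truncnS_gt _))// ler_nat.
have c0 : 0 <= c by rewrite !mulr_ge0 ?addr_ge0 ?nm_ge0.
have k1 : 1 <= k%:R :> R.
  by have := nm_ge0 B; have := nm_ge0 C; lra.
have hB : nm (invmx (B + k%:R%:M)) * k%:R <= 2 * n%:R.
  apply: invmx_add_nat_norm_le => //.
  by have := nm_ge0 B; have := nm_ge0 C; lra.
have hC : nm (invmx (C + k%:R%:M)) * k%:R <= 2 * n%:R.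
  apply: invmx_add_nat_norm_le => //.
  by have := nm_ge0 B; have := nm_ge0 C; lra.
have hA : nm (A + k%:R%:M) <= (nm A + n%:R) * k%:R.
  rewrite (le_trans (entry_normD _ _))// -scalemx1 entry_normZ entry_norm1 normr_nat.
  rewrite mulrDl [n%:R * _]mulrC lerD2r ler_peMr ?nm_ge0//.
rewrite TS (le_trans (entry_normM _ _))// mulrC ler_wpM2r ?nm_ge0//.
rewrite entry_normZ ger0_norm ?invr_ge0//.
rewrite mulrC ler_pdivrMr//.
apply: (@le_trans _ _ c); last first.
  rewrite -[k.+1%:R]natr1.
  by have := nm_ge0 B; have := nm_ge0 C; lra.
rewrite (le_trans (entry_normM _ _))//.
rewrite (le_trans (ler_wpM2r (nm_ge0 _) (entry_normM _ _)))//.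
rewrite (le_trans (ler_wpM2r (nm_ge0 _) (ler_wpM2r (nm_ge0 _) (entry_normM _ _))))//.
have k0' : 0 < k%:R :> R by rewrite (lt_le_trans _ k1).
move: hB hC hA (nm_ge0 Z) (nm_ge0 (A + k%:R%:M)) (nm_ge0 A).
move: (nm_ge0 (invmx (B + k%:R%:M))) (nm_ge0 (invmx (C + k%:R%:M))); rewrite /c; move: (2 * n%:R) => p.
move: (nm (invmx (B + _))) (nm (invmx (C + _))) (nm (A + _)) (nm Z) (nm A).
move=> b b' a z a' b0 b'0 hB hC hA z0 a0 a'0.
rewrite -!mulrA ler_wpM2l//.
apply: (@le_trans _ _ ((a' + n%:R) * k%:R * b * b')).
  by rewrite mulrA ler_wpM2r// ler_wpM2r.
rewrite -!mulrA ler_wpM2l ?addr_ge0// mulrA (mulrC _ b).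
apply: ler_pM => //; first by rewrite mulr_ge0// ltW.
by rewrite (le_trans _ hC)// ler_peMr.
Qed.

End BetaSeries.

(** * Limits of complex numbers and matrices *)

Section ComplexEntries.
Context {R : realType}.
Implicit Types (x y z : R[i]).

Lemma Re_add x y : complex.Re (x + y) = complex.Re x + complex.Re y.
Proof. by case: x => a b; case: y. Qed.

Lemma Im_add x y : complex.Im (x + y) = complex.Im x + complex.Im y.
Proof. by case: x => a b; case: y. Qed.

Lemma Re_mul x y :
  complex.Re (x * y) = complex.Re x * complex.Re y - complex.Im x * complex.Im y.
Proof. by case: x => a b; case: y. Qed.

Lemma Im_mul x y :
  complex.Im (x * y) = complex.Re x * complex.Im y + complex.Im x * complex.Re y.
Proof. by case: x => a b; case: y. Qed.

Lemma Re_bigsum I (r : seq I) (F : I -> R[i]) :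
  complex.Re (\sum_(i <- r) F i) = \sum_(i <- r) complex.Re (F i).
Proof. by apply: big_morph => //; exact: Re_add. Qed.

Lemma Im_bigsum I (r : seq I) (F : I -> R[i]) :
  complex.Im (\sum_(i <- r) F i) = \sum_(i <- r) complex.Im (F i).
Proof. by apply: big_morph => //; exact: Im_add. Qed.

Lemma normc_Re_le x : `|complex.Re x| <= ComplexField.Normc.normc x.
Proof.
case: x => a b /=; rewrite -sqrtr_sqr ler_sqrt ?addr_ge0 ?sqr_ge0//.
by rewrite lerDl sqr_ge0.
Qed.

Lemma normc_Im_le x : `|complex.Im x| <= ComplexField.Normc.normc x.
Proof.
case: x => a b /=; rewrite -sqrtr_sqr ler_sqrt ?addr_ge0 ?sqr_ge0//.
by rewrite lerDr sqr_ge0.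
Qed.

Lemma normc_le_ReIm x : ComplexField.Normc.normc x <= `|complex.Re x| + `|complex.Im x|.
Proof.
case: x => a b /=.
rewrite -[leRHS]ger0_norm ?addr_ge0// -sqrtr_sqr ler_sqrt ?sqr_ge0//.
rewrite sqrrD !real_normK ?num_real// -addrA lerD2l lerDr.
by rewrite mulrn_wge0// mulr_ge0.
Qed.

Lemma complex_cvg (u : nat -> R[i]) (l : R[i]) :
  complex.Re (u k) @[k --> \oo] --> complex.Re l ->
  complex.Im (u k) @[k --> \oo] --> complex.Im l -> u @ \oo --> l.
Proof.
move=> cRe cIm; apply/cvgrPdist_lt => e e0.
have e2 : 0 < complex.Re e / 2.
  by rewrite divr_gt0//; move: e0; rewrite ltcE => /andP[].
have eE : e = (complex.Re e)%:C.
  by move: e0; rewrite ltcE /= => /andP[/eqP + _]; case: (e) => a b /= ->.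
move/cvgrPdist_lt : cRe => /(_ _ e2) h1; move/cvgrPdist_lt : cIm => /(_ _ e2) h2.
near=> k.
rewrite eE -[`|_|]/((ComplexField.Normc.normc (l - u k))%:C) ltcR.
rewrite (le_lt_trans (normc_le_ReIm _))//.
have -> : complex.Re (l - u k) = complex.Re l - complex.Re (u k).
  by case: (l) => a b; case: (u k).
have -> : complex.Im (l - u k) = complex.Im l - complex.Im (u k).
  by case: (l) => a b; case: (u k).
rewrite [ltRHS]splitr; apply: ltrD; first by near: k.
by near: k.
Unshelve. all: by end_near. Qed.

End ComplexEntries.

Section ComplexMatrixTopology.
Context {R : realType} {N : nat}.

(** Needed for limits of complex matrices to be determined by their entries. *)
Lemma complex_matrix_hausdorff : hausdorff_space ('M[R[i]]_N).
Proof.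
move=> P Q PQ; apply/matrixP => i j.
apply: (@norm_hausdorff _ R[i]^o) => U V PU QV.
have := PQ _ _ (@coord_continuous R[i] N N i j P U PU)
               (@coord_continuous R[i] N N i j Q V QV).
by move=> [M [MU MV]]; exists (M i j).
Qed.

Lemma complex_matrix_cvg (u : nat -> 'M[R[i]]_N) (L : 'M[R[i]]_N) :
  (forall i j, u k i j @[k --> \oo] --> L i j) -> u @ \oo --> L.
Proof.
move=> uL A [P LP PA].
have : \forall k \near \oo, forall ij : 'I_N * 'I_N, P ij.1 ij.2 (u k ij.1 ij.2).
  by apply: filter_forall => -[i j] /=; exact: (uL i j _ (LP i j)).
by apply: filterS => k Pk; apply: PA => i j; exact: (Pk (i, j)).
Qed.

End ComplexMatrixTopology.

(** * Complex matrices as real matrices of twice the size *)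

Section Realification.
Context {R : realType} {N : nat}.
Implicit Types (A B M W : 'M[R[i]]_N).

(** The real algebra morphism sending X + iY to a real matrix of twice the
    size; its entries are the real and imaginary parts up to sign, so limits,
    integrals and products may be computed on either side. *)
Definition realify M : 'M[R]_(N + N) :=
  block_mx (map_mx (@complex.Re R) M) (map_mx (@complex.Im R) M)
           (- map_mx (@complex.Im R) M) (map_mx (@complex.Re R) M).

Lemma realify_ul M i j : realify M (lshift N i) (lshift N j) = complex.Re (M i j).
Proof. by rewrite block_mxEul mxE. Qed.

Lemma realify_ur M i j : realify M (lshift N i) (rshift N j) = complex.Im (M i j).
Proof. by rewrite block_mxEur mxE. Qed.

Lemma realify_dl M i j : realify M (rshift N i) (lshift N j) = - complex.Im (M i j).
Proof. by rewrite block_mxEdl !mxE. Qed.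

Lemma realify_dr M i j : realify M (rshift N i) (rshift N j) = complex.Re (M i j).
Proof. by rewrite block_mxEdr mxE. Qed.

Definition realifyE := (realify_ul, realify_ur, realify_dl, realify_dr).

Lemma block_matrixP (X Y : 'M[R]_(N + N)) :
  (forall i j, [/\ X (lshift N i) (lshift N j) = Y (lshift N i) (lshift N j),
    X (lshift N i) (rshift N j) = Y (lshift N i) (rshift N j),
    X (rshift N i) (lshift N j) = Y (rshift N i) (lshift N j) &
    X (rshift N i) (rshift N j) = Y (rshift N i) (rshift N j)]) -> X = Y.
Proof.
move=> XY; apply/matrixP => i j.
by case: (split_ordP i) => i' ->; case: (split_ordP j) => j' ->;
  have [] := XY i' j'.
Qed.

Lemma realify_inj : injective realify.
Proof.
move=> M W MW; apply/matrixP => i j.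
apply/eqP; rewrite eq_complex -!realify_ul -!realify_ur MW.
by rewrite !eqxx.
Qed.

Lemma realifyD M W : realify (M + W) = realify M + realify W.
Proof.
by apply: block_matrixP => i j; split; rewrite [RHS]mxE !realifyE !mxE
  ?Re_add ?Im_add ?opprD.
Qed.

Lemma realify0 : realify 0 = 0.
Proof. by apply: (addrI (realify 0)); rewrite -realifyD !addr0. Qed.

Lemma realifyN M : realify (- M) = - realify M.
Proof. by apply: (addrI (realify M)); rewrite -realifyD !subrr realify0. Qed.

Lemma realify_sum m (F : nat -> 'M[R[i]]_N) :
  realify (\sum_(k < m) F k) = \sum_(k < m) realify (F k).
Proof. by apply: big_morph; [exact: realifyD|exact: realify0]. Qed.

Lemma realifyM M W : realify (M *m W) = realify M *m realify W.
Proof.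
rewrite /realify mulmx_block.
have Re_mulmx : map_mx (@complex.Re R) (M *m W) =
    map_mx (@complex.Re R) M *m map_mx (@complex.Re R) W -
    map_mx (@complex.Im R) M *m map_mx (@complex.Im R) W.
  apply/matrixP => i j; rewrite !mxE Re_bigsum -sumrB.
  by apply: eq_bigr => k _; rewrite !mxE Re_mul.
have Im_mulmx : map_mx (@complex.Im R) (M *m W) =
    map_mx (@complex.Re R) M *m map_mx (@complex.Im R) W +
    map_mx (@complex.Im R) M *m map_mx (@complex.Re R) W.
  apply/matrixP => i j; rewrite !mxE Im_bigsum -big_split.
  by apply: eq_bigr => k _; rewrite !mxE Im_mul.
rewrite Re_mulmx Im_mulmx !mulmxN !mulNmx; congr block_mx.
  by rewrite opprD addrC.
by rewrite addrC.
Qed.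

Lemma realifyZ (x : R) M : realify (x%:C *: M) = x *: realify M.
Proof.
by apply: block_matrixP => i j; split; rewrite [RHS]mxE !realifyE !mxE
  ?Re_mul ?Im_mul /= !mul0r ?subr0 ?addr0 ?mulrN.
Qed.

Lemma realify1 : realify 1%:M = 1%:M.
Proof.
have ReN k : complex.Re (1 *+ nat_of_bool k : R[i]) = 1 *+ nat_of_bool k by case: k.
have ImN k : complex.Im (1 *+ nat_of_bool k : R[i]) = 0 by case: k.
by apply: block_matrixP => i j; split; rewrite realifyE !mxE ?ReN ?ImN ?oppr0
  ?eq_lshift ?eq_lrshift ?eq_rlshift ?eq_rshift.
Qed.

Lemma realify_nat k : realify k%:R%:M = k%:R%:M.
Proof.
rewrite -scalemx1 -[k%:R in LHS](rmorph_nat (real_complex R)).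
by rewrite realifyZ realify1 scalemx1.
Qed.

Lemma realifyX M k : realify (M ^+ k) = realify M ^+ k.
Proof.
elim: k => [|k IH]; first by rewrite !expr0 realify1.
by rewrite !exprS -!mulmxE realifyM IH.
Qed.

Lemma realify_comm {M W} : comm_mx M W -> comm_mx (realify M) (realify W).
Proof. by rewrite /comm_mx -!realifyM => ->. Qed.

Lemma realify_unit {M} : realify M \in unitmx -> M \in unitmx.
Proof.
move=> Mu; apply: unitmx_kernel => W WM; apply: realify_inj; rewrite realify0.
by rewrite -(mulmxK Mu (realify W)) -realifyM WM realify0 mul0mx.
Qed.

Lemma realify_inv {M} : M \in unitmx -> realify (invmx M) = invmx (realify M).
Proof.
move=> Mu; have E : realify M *m realify (invmx M) = 1%:M.
  by rewrite -realifyM mulmxV// realify1.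
have [rMu _] := mulmx1_unit E.
by rewrite -(mulKmx rMu (realify (invmx M))) E mulmx1.
Qed.

Lemma realify_cvg {u : nat -> 'M[R[i]]_N} {X : 'M[R]_(N + N)} :
  (fun k => realify (u k)) ~> X ->
  exists2 L : 'M[R[i]]_N, realify L = X & u @ \oo --> L.
Proof.
move=> uX.
pose L : 'M[R[i]]_N := \matrix_(i, j)
  (X (lshift N i) (lshift N j) +i* X (lshift N i) (rshift N j)).
have uRe i j : complex.Re (u k i j) @[k --> \oo] --> complex.Re (L i j).
  have := uX (lshift N i) (lshift N j); rewrite mxE /=.
  by under eq_fun do rewrite realify_ul.
have uIm i j : complex.Im (u k i j) @[k --> \oo] --> complex.Im (L i j).
  have := uX (lshift N i) (rshift N j); rewrite mxE /=.
  by under eq_fun do rewrite realify_ur.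
exists L; last by apply: complex_matrix_cvg => i j; exact: complex_cvg.
apply: mx_cvg_unique uX => i j.
case: (split_ordP i) => i' ->; case: (split_ordP j) => j' ->;
  rewrite realifyE; under eq_fun do rewrite realifyE => //.
- exact: uRe.
- exact: uIm.
- by apply: cvgN; exact: uIm.
- exact: uRe.
Qed.

Lemma realify_series {u : nat -> 'M[R[i]]_N} {X : 'M[R]_(N + N)} :
  (fun m => \sum_(k < m) realify (u k)) ~> X ->
  cvgn (series u) /\ realify (limn (series u)) = X.
Proof.
move=> uX; have [|L LX uL] := @realify_cvg (series u) X.
  by apply: mx_cvg_eq uX => m; rewrite /series/= big_mkord realify_sum.
split; first by apply: cvgP uL.
by rewrite -LX; congr realify; apply: cvg_lim => //; exact: complex_matrix_hausdorff.
Qed.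

Lemma realify_mx_exp M : realify (mx_exp M) = mexp (realify M).
Proof.
have lim := mx_sum_cvg (exp_summable (realify M)).
apply: (proj2 (realify_series _)); apply: mx_cvg_eq lim => m.
apply: eq_bigr => k _; rewrite /mx_exp_term -realifyX -realifyZ; congr (realify (_ *: _)).
by rewrite fmorphV rmorph_nat.
Qed.

Lemma realify_rpow t M : realify (mx_rpow t M) = rpow t (realify M).
Proof. by rewrite /mx_rpow realify_mx_exp realifyZ. Qed.

Lemma realify_pochhammer M k : realify (mx_pochhammer M k) = rising (realify M) k.
Proof.
elim: k => [|k IH]; first by rewrite /mx_pochhammer big_ord0 rising0 realify1.
rewrite risingS -IH /mx_pochhammer big_ord_recr /= -mulmxE realifyM.
by rewrite realifyD realify_nat.
Qed.

Lemma realify_integral {D : set R} {F : R -> 'M[R[i]]_N} : measurable D ->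
  entry_integrable D (fun t => realify (F t)) ->
  mx_integrable D F /\
  realify (mx_integral D F) = entry_integral D (fun t => realify (F t)).
Proof.
move=> mD iF; have iM : mx_integrable D F.
  move=> i j; split.
    by have := iF (lshift N i) (lshift N j); under eq_fun do rewrite realify_ul.
  by have := iF (lshift N i) (rshift N j); under eq_fun do rewrite realify_ur.
split => //; apply: block_matrixP => i j; rewrite !realifyE !mxE /=.
split; apply/esym.
- by apply: eq_Rintegral => t _; rewrite realify_ul.
- by apply: eq_Rintegral => t _; rewrite realify_ur.
- under eq_Rintegral do rewrite realify_dl -mulN1r.
  by rewrite RintegralZl ?mulN1r//; exact: (iM i j).2.
- by apply: eq_Rintegral => t _; rewrite realify_dr.
Qed.

Lemma realify_Gamma {M} : mx_stable (realify M) ->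
  realify (mx_Gamma M) = mgamma (realify M).
Proof.
move=> sM.
have E t : realify (mx_Gamma_integrand M t) = gamma_integrand (realify M) t.
  by rewrite /mx_Gamma_integrand realifyZ realify_rpow realifyD realifyN realify1.
have iG : entry_integrable `]0, +oo[ (fun t => realify (mx_Gamma_integrand M t)).
  apply: (eq_entry_integrable (gamma_integrand (realify M))) => //.
  exact: gamma_integrable.
rewrite /mx_Gamma (proj2 (realify_integral _ iG))// mgamma.unlock.
by apply: eq_entry_integral => t _; rewrite E.
Qed.

End Realification.

(** * Positive stability implies decay of t^A *)

Section SpectralBound.
Context {R : realType}.
Local Notation normc := (@ComplexField.Normc.normc R).

Lemma normc_ge0 (x : R[i]) : 0 <= normc x.
Proof. by case: x => a b; rewrite /= sqrtr_ge0. Qed.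

Section Size.
Context {N : nat}.
Implicit Types (A M P X : 'M[R[i]]_N).

Definition complex_entry_norm M : R := \sum_i \sum_j normc (M i j).
Local Notation nmC := complex_entry_norm.

Lemma complex_entry_norm_ge0 M : 0 <= nmC M.
Proof. by apply: sumr_ge0 => i _; apply: sumr_ge0 => j _; exact: normc_ge0. Qed.

Lemma complex_entry_normD M X : nmC (M + X) <= nmC M + nmC X.
Proof.
rewrite /nmC -big_split/=; apply: ler_sum => i _.
rewrite -big_split/=; apply: ler_sum => j _.
by rewrite mxE; exact: le_normcD.
Qed.

Lemma complex_entry_normZ (a : R[i]) M : nmC (a *: M) = normc a * nmC M.
Proof.
rewrite /nmC mulr_sumr; apply: eq_bigr => i _.
rewrite mulr_sumr; apply: eq_bigr => j _; rewrite mxE.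
exact: ComplexField.Normc.normcM.
Qed.

Lemma realify_norm_le M : nm (realify M) <= 4 * nmC M.
Proof.
have -> : 4 * nmC M = (nmC M + nmC M) + (nmC M + nmC M).
  by ring.
rewrite /entry_norm big_split_ord/=; apply: lerD.
  rewrite /nmC -big_split/=; apply: ler_sum => i _.
  rewrite big_split_ord/=; apply: lerD; apply: ler_sum => j _; rewrite realifyE.
    exact: normc_Re_le.
  exact: normc_Im_le.
rewrite /nmC -big_split/=; apply: ler_sum => i _.
rewrite big_split_ord/=; apply: lerD; apply: ler_sum => j _; rewrite realifyE.
  by rewrite normrN; exact: normc_Im_le.
exact: normc_Re_le.
Qed.

(** Peeling off one linear factor of an annihilating polynomial at a time turns
    a bound on its roots into a geometric bound on the powers of [P]: if p is a
    root, X P^(k+1) = p X P^k + X (P - p) P^k, whose last term is bounded by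
    induction on the number of factors. *)
Lemma annihilated_power_bounded P (s : seq R[i]) (rho r : R) :
  0 <= rho -> rho < r -> (forall p, p \in s -> normc p <= rho) ->
  forall X, X *m (\prod_(p <- s) (P - p%:M)) = 0 ->
  exists2 c : R, 0 <= c & forall k, nmC (X *m P ^+ k) <= c * r ^+ k.
Proof.
move=> rho0 rhor; have r0 : 0 < r by rewrite (le_lt_trans rho0).
elim: s => [|p s IH] ps X.
  rewrite big_nil -[1]/(1%:M) mulmx1 => ->; exists 0 => // k.
  rewrite mul0mx mul0r /nmC big1// => i _; rewrite big1// => j _.
  by rewrite mxE; exact: ComplexField.Normc.normc0.
rewrite big_cons -mulmxE mulmxA => /IH[|c c0 Xc].
  by move=> q qs; apply: ps; rewrite inE qs orbT.
have prho : normc p <= rho by apply: ps; rewrite inE eqxx.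
(* chosen so that rho * c' + c <= r * c' *)
pose c' := nmC X + c / (r - rho).
have rr : 0 < r - rho by rewrite subr_gt0.
have c'0 : 0 <= c' by rewrite addr_ge0 ?complex_entry_norm_ge0// divr_ge0// ltW.
have cc' : c <= (r - rho) * c'.
  rewrite /c' mulrDr [(r - rho) * (c / _)]mulrCA divff ?gt_eqF// mulr1 lerDr.
  by rewrite mulr_ge0 ?complex_entry_norm_ge0// ltW.
exists c' => // k; elim: k => [|k IHk].
  by rewrite !expr0 -[1]/(1%:M) mulmx1 mulr1 lerDl divr_ge0// ltW.
have -> : X *m P ^+ k.+1 = p *: (X *m P ^+ k) + X *m (P - p%:M) *m P ^+ k.
  rewrite exprS -mulmxE mulmxBr mulmxBl -mulmxA addrC mul_mx_scalar -scalemxAl.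
  by rewrite subrK.
rewrite (le_trans (complex_entry_normD _ _))// complex_entry_normZ.
have rk : 0 <= r ^+ k by rewrite exprn_ge0// ltW.
have h1 : normc p * nmC (X *m P ^+ k) <= rho * (c' * r ^+ k).
  by apply: ler_pM; rewrite ?normc_ge0 ?complex_entry_norm_ge0.
apply: (le_trans (lerD h1 (Xc k))).
rewrite exprS [leRHS](_ : _ = rho * (c' * r ^+ k) + (r - rho) * c' * r ^+ k).
  by rewrite lerD2l ler_wpM2r.
by ring.
Qed.

Lemma annihilated_rescaled A (h : R[i]) (s : seq R[i]) :
  exists c : R[i], \prod_(p <- [seq 1 - h * a | a <- s]) (1%:M - h *: A - p%:M) =
    c *: \prod_(a <- s) (A - a%:M).
Proof.
elim: s => [|a s [c IH]]; first by exists 1; rewrite !big_nil scale1r.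
exists (- h * c); rewrite !big_cons IH -!mulmxE -scalemxAr -scalerA.
have -> : 1%:M - h *: A - (1 - h * a)%:M = - h *: (A - a%:M).
  apply/matrixP => i j; rewrite !mxE -(mulr_natr 1) -(mulr_natr (1 - h * a)).
  by rewrite -(mulr_natr a); ring.
by rewrite -scalemxAl !scalerA (mulrC c).
Qed.

End Size.

Lemma char_poly_annihilates {N : nat} (A : 'M[R[i]]_N) :
  exists2 s : seq R[i], (forall a, a \in s -> eigenvalue A a) &
    \prod_(a <- s) (A - a%:M) = 0.
Proof.
case: N A => [|N] A.
  by exists [::] => //; apply/matrixP => -[].
have [s sE] := closed_field_poly_normal (char_poly A).
rewrite (monicP (char_poly_monic A)) scale1r in sE.
exists s => [a as_|].
  by rewrite eigenvalue_root_char sE root_prod_XsubC.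
have := Cayley_Hamilton A; rewrite sE rmorph_prod/= => <-.
by apply: eq_bigr => a _; rewrite rmorphB/= horner_mx_X horner_mx_C.
Qed.

(** |1 - ha|^2 = 1 - 2h Re a + h^2 |a|^2, less than 1 for small h as Re a > 0. *)
Lemma contraction_step (s : seq R[i]) : (forall a, a \in s -> 0 < complex.Re a) ->
  exists2 h0 : R, 0 < h0 &
    forall h, 0 < h -> h <= h0 -> forall a, a \in s -> normc (1 - h%:C * a) < 1.
Proof.
elim: s => [|a s IH] s0; first by exists 1.
have [|h1 h10 H1] := IH; first by move=> b bs; apply: s0; rewrite inE bs orbT.
have Ra : 0 < complex.Re a by apply: s0; rewrite inE eqxx.
pose q := complex.Re a ^+ 2 + complex.Im a ^+ 2.
have q0 : 0 < q by rewrite ltr_wpDr ?sqr_ge0// exprn_gt0.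
exists (Num.min h1 (complex.Re a / q)).
  by rewrite lt_min h10 divr_gt0.
move=> h hp; rewrite le_min => /andP[hh1 hh2] b; rewrite inE => /predU1P[->|]; last exact: H1.
have : h * q <= complex.Re a by rewrite -ler_pdivlMr.
rewrite /q; move: Ra; case: (a) => x y /= x0 hq.
rewrite -[X in _ < X]sqrtr1 ltr_sqrt// !mul0r subr0 addr0 sub0r.
by nra.
Qed.

Lemma uniform_bound (s : seq R[i]) : (forall p, p \in s -> normc p < 1) ->
  exists2 rho : R, 0 <= rho < 1 & forall p, p \in s -> normc p <= rho.
Proof.
elim: s => [|p s IH] s1; first by exists 0; rewrite ?lexx ?ltr01.
have [|rho /andP[rho0 rho1] H] := IH; first by move=> q qs; apply: s1; rewrite inE qs orbT.
exists (Num.max rho (normc p)).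
  by rewrite le_max rho0/= gt_max rho1 s1// inE eqxx.
move=> q; rewrite inE => /predU1P[->|qs]; first by rewrite le_max lexx orbT.
by rewrite le_max H.
Qed.

(** For small h the eigenvalues 1 - ha of P = 1 - hA have modulus less than 1,
    so the powers of P decay geometrically. *)
Theorem positive_stable_realify {N : nat} {A : 'M[R[i]]_N} :
  positive_stable A -> mx_stable (realify A).
Proof.
move=> sA; have [s eigs As] := char_poly_annihilates A.
have [|h h0 hs] := @contraction_step s; first by move=> a /eigs; exact: sA.
have [|rho /andP[rho0 rho1] Hrho] := @uniform_bound [seq 1 - h%:C * a | a <- s].
  by move=> p /mapP[a as_ ->]; exact: hs.
pose r := (rho + 1) / 2.
have rr : rho < r by rewrite /r; lra.
have r1 : r < 1 by rewrite /r; lra.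
pose P := 1%:M - h%:C *: A.
have [|c c0 Pc] := @annihilated_power_bounded N P _ rho r rho0 rr Hrho 1%:M.
  by have [c ->] := annihilated_rescaled A h%:C s; rewrite As scaler0 mulmx0.
apply: (@power_bounded_stable _ _ _ h r (4 * c)) => // [|k].
  by rewrite mulr_ge0.
have -> : 1%:M - h *: realify A = realify P.
  by rewrite /P realifyD realifyN realifyZ realify1.
rewrite -realifyX (le_trans (realify_norm_le _))// -mulrA ler_wpM2l//.
by have := Pc k; rewrite mul1mx.
Qed.

End SpectralBound.

(** * Hypergeometric series and the Beta transform *)

Lemma mulmx_swap {R : pzSemiRingType} {n : nat} {X Y : 'M[R]_n} (W : 'M[R]_n) :
  comm_mx X Y -> X *m (Y *m W) = Y *m (X *m W).
Proof. by move=> XY; rewrite mulmxA XY mulmxA. Qed.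

Lemma invmx_mul {R : comUnitRingType} {n : nat} {X Y : 'M[R]_n} :
  X \in unitmx -> Y \in unitmx -> comm_mx X Y -> invmx (X *m Y) = invmx X *m invmx Y.
Proof.
move=> uX uY XY; have uXY : X *m Y \in unitmx by rewrite unitmx_mul uX.
by rewrite -[RHS](mulKmx uXY) XY -!mulmxA mulKVmx// mulmxV// mulmx1.
Qed.

Section HypergeometricIntegral.
Context {R : realType} {N : nat} {A B C A1 D1 : 'M[R[i]]_N}.
Hypotheses (AB : comm_mx A B) (AC : comm_mx A C) (BC : comm_mx B C)
  (AA1 : comm_mx A A1) (BA1 : comm_mx B A1)
  (AD1 : comm_mx A D1) (BD1 : comm_mx B D1)
  (A1D1 : comm_mx A1 D1).
Hypotheses (sB : mx_stable (realify B)) (sC : mx_stable (realify C))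
  (sA1 : mx_stable (realify A1)) (sD1 : mx_stable (realify D1)).

Let realify_scale (w : R[i]) (M : 'M[R[i]]_N) :
  realify (w *: M) = realify w%:M *m realify M.
Proof. by rewrite -realifyM mul_scalar_mx. Qed.

Let scale_comm (w : R[i]) (M : 'M[R[i]]_N) : comm_mx (realify w%:M) (realify M).
Proof. by apply: realify_comm; rewrite /comm_mx scalar_mxC. Qed.

Let realify_inv_pochhammer (M : 'M[R[i]]_N) k : mx_stable (realify M) ->
  realify (invmx (mx_pochhammer M k)) = invmx (rising (realify M) k).
Proof.
move=> sM; rewrite realify_inv ?realify_pochhammer//.
by apply: realify_unit; rewrite realify_pochhammer; exact: rising_unit.
Qed.

Let term z k : realify (hyp1F2_term A B C z k) =
  realify (z ^+ k / k`!%:R)%:M *m (rising (realify A) k *m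
    invmx (rising (realify B) k) *m invmx (rising (realify C) k)).
Proof.
by rewrite /hyp1F2_term realify_scale !realifyM realify_pochhammer !realify_inv_pochhammer.
Qed.

Let add_nat_unit (M : 'M[R[i]]_N) k : mx_stable (realify M) ->
  realify M + k%:R%:M \in unitmx.
Proof. by move=> sM; apply: mx_stable_unit; exact: mx_stable_add_scalar. Qed.

Let rising_invS (M : 'M[R[i]]_N) k : mx_stable (realify M) ->
  invmx (rising (realify M) k.+1) =
  invmx (rising (realify M) k) *m invmx (realify M + k%:R%:M).
Proof.
move=> sM; rewrite risingS invmx_mul//; [exact: rising_unit|exact: add_nat_unit|].
by apply/comm_mx_sym/comm_rising/comm_mx_sym/comm_mx_add_scalar.
Qed.

Lemma hyp1F2_summable z : mx_summable (fun k => realify (hyp1F2_term A B C z k)).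
Proof.
apply: (@hypergeometric_summable _ _ (realify z%:M) (realify A) (realify B) (realify C)).
- by move=> k; exact: add_nat_unit.
- by move=> k; exact: add_nat_unit.
move=> k; rewrite !term risingS !rising_invS//.
have -> : realify ((z ^+ k.+1 / k.+1`!%:R)%:M : 'M[R[i]]_N) =
    k.+1%:R^-1 *: (realify (z ^+ k / k`!%:R)%:M *m realify z%:M).
  rewrite -realifyM -realifyZ -scalar_mxM scale_scalar_mx; congr (realify _%:M).
  by rewrite fmorphV rmorph_nat factS natrM invfM exprSr; ring.
rewrite -scalemxAr -scalemxAl; congr (_ *: _); rewrite -!mulmxA.
have comm_shift (X Y : 'M[R]_(N + N)) m : comm_mx X Y -> comm_mx (Y + m%:R%:M) X.
  by move=> XY; apply/comm_mx_sym/comm_mx_add_scalar.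
have rBZ : comm_mx (invmx (rising (realify B) k)) (realify z%:M).
  by apply/comm_mx_sym/comm_invmx/comm_rising/scale_comm.
have rCZ : comm_mx (invmx (rising (realify C) k)) (realify z%:M).
  by apply/comm_mx_sym/comm_invmx/comm_rising/scale_comm.
have rAZ : comm_mx (rising (realify A) k) (realify z%:M).
  by apply/comm_mx_sym/comm_rising/scale_comm.
have rBA : comm_mx (invmx (rising (realify B) k)) (realify A + k%:R%:M).
  by apply/comm_mx_sym/comm_invmx/comm_rising/comm_shift/realify_comm.
have rCA : comm_mx (invmx (rising (realify C) k)) (realify A + k%:R%:M).
  by apply/comm_mx_sym/comm_invmx/comm_rising/comm_shift/realify_comm.
have rCB : comm_mx (invmx (rising (realify C) k)) (invmx (realify B + k%:R%:M)).
  apply/comm_invmx/comm_mx_sym/comm_invmx/comm_rising/comm_shift.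
  exact: realify_comm.
rewrite (mulmx_swap _ rCZ) (mulmx_swap _ rBZ) (mulmx_swap _ rAZ).
by rewrite (mulmx_swap _ rCA) (mulmx_swap _ rBA) (mulmx_swap _ rCB).
Qed.

Lemma hyp1F2_cvg z : cvgn (series (hyp1F2_term A B C z)) /\
  (fun m => \sum_(k < m) realify (hyp1F2_term A B C z k)) ~> realify (hyp1F2 A B C z).
Proof.
have lim := mx_sum_cvg (hyp1F2_summable z).
by have [cz ->] := realify_series lim.
Qed.

Let term2 z k : realify (hyp2F3_term A A1 B (A1 + D1) C z k) =
  rising (realify A1) k *m invmx (rising (realify A1 + realify D1) k) *m
  realify (hyp1F2_term A B C z k).
Proof.
have sE : mx_stable (realify (A1 + D1)).
  rewrite realifyD; apply: mx_stableD => //; last exact: mx_stable_bounded.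
  exact: realify_comm.
rewrite term /hyp2F3_term realify_scale !realifyM !realify_pochhammer.
rewrite !realify_inv_pochhammer// realifyD -!mulmxA.
set ra1 := rising (realify A1) k; set ie := invmx (rising (_ + _) k).
set w := realify _%:M; set ra := rising _ k; set ib := invmx (rising (realify B) k).
have a1w : comm_mx ra1 w by apply/comm_mx_sym/comm_rising/scale_comm.
have iew : comm_mx ie w.
  by rewrite /ie -realifyD; apply/comm_mx_sym/comm_invmx/comm_rising/scale_comm.
have a1a : comm_mx ra1 ra.
  by apply/comm_rising/comm_mx_sym/comm_rising/realify_comm.
have iea : comm_mx ie ra.
  rewrite /ie -realifyD; apply/comm_rising/comm_mx_sym/comm_invmx/comm_rising/realify_comm.
  exact: comm_mxD.
have ieb : comm_mx ie ib.
  rewrite /ie -realifyD.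
  apply/comm_invmx/comm_rising/comm_mx_sym/comm_invmx/comm_rising/realify_comm.
  exact: comm_mxD.
rewrite (mulmx_swap _ iew) (mulmx_swap _ a1w) (mulmx_swap _ iea) (mulmx_swap _ a1a).
by rewrite (mulmx_swap _ ieb).
Qed.

(* stated for variables, lest two occurrences of mx_Gamma be compared by
   unfolding their integrals *)
Let realify_quotient {G1 G2 G3 : 'M[R[i]]_N} {g1 g2 g3 : 'M[R]_(N + N)} :
  realify G1 = g1 -> realify G2 = g2 -> realify G3 = g3 -> g3 \in unitmx ->
  realify (G1 *m G2 *m invmx G3) = g1 *m g2 *m invmx g3.
Proof.
move=> <- <- <- uG; rewrite !realifyM realify_inv//; exact: realify_unit.
Qed.

(** Integration against the Beta kernel multiplies the k-th term by
    (A1)_k (A1+D1)_k^(-1), the factor by which the terms of 2F3 differ from those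
    of 1F2. *)
Theorem hyp1F2_beta_integral z :
  let F t := mx_rpow t (A1 - 1%:M) *m mx_rpow (1 - t) (D1 - 1%:M)
               *m hyp1F2 A B C (z * t%:C) in
  [/\ cvgn (series (hyp2F3_term A A1 B (A1 + D1) C z)),
    mx_integrable `]0, 1[ F &
    mx_integral `]0, 1[ F =
      mx_Gamma A1 *m mx_Gamma D1 *m invmx (mx_Gamma (A1 + D1))
        *m hyp2F3 A A1 B (A1 + D1) C z].
Proof.
move=> F; have cAD := realify_comm A1D1.
have sE : mx_stable (realify (A1 + D1)).
  by rewrite realifyD; apply: mx_stableD => //; exact: mx_stable_bounded.
have TS t : 0 < t -> t < 1 ->
    (fun m => \sum_(k < m) t ^+ k *: realify (hyp1F2_term A B C z k)) ~>
    realify (hyp1F2 A B C (z * t%:C)).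
  move=> _ _; apply: mx_cvg_eq (proj2 (hyp1F2_cvg (z * t%:C))) => m.
  apply: eq_bigr => k _; rewrite -realifyZ; congr realify.
  rewrite /hyp1F2_term scalerA; congr (_ *: _).
  by rewrite exprMn rmorphXn /=; ring.
have [X [QX iX EX]] := beta_series cAD sA1 sD1 (hyp1F2_summable z) TS.
have [c2 E2] : cvgn (series (hyp2F3_term A A1 B (A1 + D1) C z)) /\
    realify (hyp2F3 A A1 B (A1 + D1) C z) = X.
  apply: realify_series; apply: mx_cvg_eq QX => m.
  by apply: eq_bigr => k _; rewrite term2.
have FE t : realify (F t) =
    beta_integrand (realify A1) (realify D1) t *m realify (hyp1F2 A B C (z * t%:C)).
  rewrite /F /beta_integrand 2!realifyM; congr (_ *m _ *m _).
    by rewrite realify_rpow realifyD realifyN realify1.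
  by rewrite realify_rpow realifyD realifyN realify1.
have iF : entry_integrable `]0, 1[ (fun t => realify (F t)).
  by apply: eq_entry_integrable iX.
have [mF EF] := realify_integral (measurable_itv _) iF.
split; [exact: c2|exact: mF|apply: realify_inj].
have EG : realify (mx_Gamma A1 *m mx_Gamma D1 *m invmx (mx_Gamma (A1 + D1))) =
    mgamma (realify A1) *m mgamma (realify D1) *m invmx (mgamma (realify A1 + realify D1)).
  have gE := realify_Gamma sE; rewrite realifyD in gE.
  apply: (realify_quotient (realify_Gamma sA1) (realify_Gamma sD1) gE).
  by rewrite -realifyD; exact: mgamma_unit.
have ER := etrans (realifyM _ _) (f_equal2 mulmx EG E2).
have EI := etrans EF (eq_entry_integral _ (fun t _ => FE t)).
exact: (etrans EI (etrans EX (esym ER))).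
Qed.

End HypergeometricIntegral.

Theorem theorem2p5 (R : realType) (N : nat) (A B C A1 B1 : 'M[R[i]]_N)
    (Hcomm : all2rel comm_mxb [:: A; B; C; A1; B1])
    (HA : positive_stable A) (HB : positive_stable B) (HC : positive_stable C)
    (HA1 : positive_stable A1) (HB1 : positive_stable B1)
    (HBA : positive_stable (B1 - A1)) (HBAu : B1 - A1 \in unitmx)
    (z : R[i]) (Hz : `|z| < 1) :
  let F1 (t : R) := mx_rpow t (A1 - 1%:M) *m mx_rpow (1 - t) (B1 - A1 - 1%:M)
                      *m hyp1F2 A B C (z * t%:C) in
  let F2 (t : R) := mx_rpow t (A1 - 1%:M) *m mx_rpow (1 - t) (B1 - 1%:M)
                      *m hyp1F2 A B C (z * t%:C) in
  (* the series involved converge *)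
  [/\ forall t : R, 0 < t < 1 -> cvgn (series (hyp1F2_term A B C (z * t%:C))),
      cvgn (series (hyp2F3_term A A1 B B1 C z)) &
      cvgn (series (hyp2F3_term A A1 B (A1 + B1) C z))] /\
  (* the two integrals converge and have the stated values *)
  [/\ mx_integrable `]0, 1[ F1,
      mx_integral `]0, 1[ F1 =
        mx_Gamma A1 *m mx_Gamma (B1 - A1) *m invmx (mx_Gamma B1)
          *m hyp2F3 A A1 B B1 C z,
      mx_integrable `]0, 1[ F2 &
      mx_integral `]0, 1[ F2 =
        mx_Gamma A1 *m mx_Gamma B1 *m invmx (mx_Gamma (A1 + B1))
          *m hyp2F3 A A1 B (A1 + B1) C z].
Proof.
move=> F1 F2.
have comm M W : M \in [:: A; B; C; A1; B1] -> W \in [:: A; B; C; A1; B1] -> comm_mx M W.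
  by move=> Ms Ws; apply/comm_mxP; exact: (allrelP Hcomm).
have [AB AC BC] : [/\ comm_mx A B, comm_mx A C & comm_mx B C].
  by split; apply: comm; rewrite !inE eqxx ?orbT.
have [AA1 BA1 AB1] : [/\ comm_mx A A1, comm_mx B A1 & comm_mx A B1].
  by split; apply: comm; rewrite !inE eqxx ?orbT.
have [BB1 A1B1] : comm_mx B B1 /\ comm_mx A1 B1.
  by split; apply: comm; rewrite !inE eqxx ?orbT.
have sB := positive_stable_realify HB; have sC := positive_stable_realify HC.
have sA1 := positive_stable_realify HA1; have sB1 := positive_stable_realify HB1.
have sBA := positive_stable_realify HBA.
have E1 : A1 + (B1 - A1) = B1 by rewrite addrC subrK.
have [c1 i1 e1] := hyp1F2_beta_integral AB AC BC AA1 BA1 (comm_mxB AB1 AA1)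
  (comm_mxB BB1 BA1) (comm_mxB A1B1 (comm_mx_refl A1)) sB sC sA1 sBA z.
have [c2 i2 e2] := hyp1F2_beta_integral AB AC BC AA1 BA1 AB1 BB1 A1B1 sB sC sA1 sB1 z.
rewrite E1 in c1 e1.
split; split; [|exact: c1|exact: c2|exact: i1|exact: e1|exact: i2|exact: e2].
by move=> t _; exact: (proj1 (hyp1F2_cvg AB AC BC sB sC _)).
Qed.
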